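(* Let $C=\{(x,y,z)\in\mathbb{R}^3:\ \max\{|x|,|y|,|z|\}\le 1,\ |x|+|y|+|z|\le 2\}$ be the regular cuboctahedron and let $T\subset\mathbb{R}^3$ be a regular tetrahedron. Then $$\delta^t(C)\le \frac{90\sqrt{10}}{95\sqrt{10}-4}\qquad\text{and}\qquad \delta^t(T)\le \frac{36\sqrt{10}}{95\sqrt{10}-4}.$$
   Context: For a convex body $K\subset\mathbb{R}^3$ and a discrete set $X\subset\mathbb{R}^3$, $K+X$ is a (translative) packing if the translates $K+\mathbf{x}$, $\mathbf{x}\in X$, have pairwise disjoint interiors. Let $W=[-1,1]^3$. The upper density of a packing $K+X$ is $$\delta(K,X)=\limsup_{\ell\to\infty}\frac{n(\ell)\,\mathrm{vol}(K)}{\mathrm{vol}(\ell W)},\qquad n(\ell)=|X\cap \ell W|,$$ and $\delta^t(K)=\sup_X \delta(K,X)$, the supremum being over all discrete sets $X$ such that $K+X$ is a packing. The value $\delta^t(K)$ is invariant under nonsingular affine transformations of $K$. *)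

(* Defs.v *)
From HB Require Import structures.
From mathcomp Require Import all_boot all_order all_algebra.
From mathcomp Require Import all_classical all_reals all_analysis.

Set Implicit Arguments.
Unset Strict Implicit.
Unset Printing Implicit Defensive.

Import Order.TTheory GRing.Theory Num.Theory.
Import numFieldNormedType.Exports.

Local Open Scope classical_set_scope.
Local Open Scope ring_scope.

(* R^3 is the product (R * R) * R, which carries the vector space structure,
   the (usual) product topology and the product of the Borel sigma-algebras.
   The library norm on this type is the sup norm, not the Euclidean one. *)
Notation space3 R := (R * R * R)%type.

Section Space.
Variable R : realType.
Implicit Types (K X : set (space3 R)) (p q : space3 R).

Definition euclidean_dist p q : R :=
  Num.sqrt ((p.1.1 - q.1.1) ^+ 2 + (p.1.2 - q.1.2) ^+ 2 + (p.2 - q.2) ^+ 2).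

Definition vol K : \bar R :=
  ((lebesgue_measure \x lebesgue_measure) \x lebesgue_measure)%E K.

Definition translate K p : set (space3 R) := [set k + p | k in K].

Definition dilate (l : R) K : set (space3 R) := [set l *: k | k in K].

Definition is_discrete X : Prop := X `<=` isolated X.

Definition packing K X : Prop :=
  trivIset X (fun x => interior (translate K x)).

Definition cubeW : set (space3 R) :=
  [set p | [/\ p.1.1 \in `[-1, 1], p.1.2 \in `[-1, 1] & p.2 \in `[-1, 1]]].

(* [counting] is the number of elements of a set, +oo if it is infinite. *)
Definition upper_density K X : \bar R :=
  limf_esup
    (fun l : R =>
       counting (X `&` dilate l cubeW) * vol K / vol (dilate l cubeW))%E
    (pinfty_nbhs R).

(* Intended for convex bodies K, which are compact and hence Borel. *)
Definition translative_density K : \bar R :=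
  ereal_sup [set upper_density K X | X in [set X | is_discrete X /\ packing K X]].

Definition cuboctahedron : set (space3 R) :=
  [set p | Num.max (Num.max `|p.1.1| `|p.1.2|) `|p.2| <= 1 /\
           `|p.1.1| + `|p.1.2| + `|p.2| <= 2].

Definition convex_hull K : set (space3 R) := smallest (@convex_set R _) K.

Definition regular_tetrahedron (T : set (space3 R)) : Prop :=
  exists (v : 'I_4 -> space3 R) (a : R),
    [/\ 0 < a,
        forall i j : 'I_4, i != j -> euclidean_dist (v i) (v j) = a &
        T = convex_hull (range v)].

End Space.

Arguments cubeW : clear implicits.
Arguments cuboctahedron : clear implicits.

(* Main.v *)
Require Import Defs.
From HB Require Import structures.
From mathcomp Require Import all_boot all_order all_algebra finmap.
From mathcomp Require Import all_classical all_reals all_analysis.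
From mathcomp Require Import ring lra.

Set Implicit Arguments.
Unset Strict Implicit.
Unset Printing Implicit Defensive.

Import Order.TTheory GRing.Theory Num.Theory.
Import numFieldNormedType.Exports.

Local Open Scope classical_set_scope.
Local Open Scope ring_scope.

(** Around each centre x of a translate of the cuboctahedron C put the box
   x + A, where A = ]-1, 17/16] x ]-1, 1]^2 is the cube circumscribed to C, made
   slightly taller. The difference t of two centres is not interior to 2C, that
   is, |t|_oo >= 2 or |t|_1 >= 4. Hence, if t points upwards, A meets t + A only
   when t is "near" (2 <= t_1 < 2 + 1/16) or a "partner" (|t|_oo < 2 <= |t|_1 / 2);
   there is at most one partner in each of the four quadrants of (t_2, t_3), and
   the cubes of partners overlap in a box with sides u_i = 2 - |t_i|, where
   u_1 + u_2 + u_3 <= 2. Without a near translate the part of A covered from above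
   has volume at most 4 (11/16)^3. A near translate squeezes the partners
   sideways, so that their overlaps with the cube sum up to at most 132/125; the
   part of A above the cube has volume 1/4. Adding the boxes from top to bottom,
   each of them therefore contributes at least 33/4 - 1/4 - 132/125 = 868/125,
   and C has density at most (20/3) / (868/125) = 625/651.

   A packing of translates of a tetrahedron T is a packing of translates of
   (T - T)/2, an affine image of C. Rather than changing variables, the argument
   runs with an arbitrary measure that scales under homotheties and translations
   as the volume does: its values on boxes, on C and on the tetrahedron inscribed
   in the cube are all determined, by dissection, by its value on the unit cube. *)

(** * Overlaps of three cubes *)

Section Corner.
Variable R : realFieldType.
Implicit Types u a b e w : R.

Lemma amgm3 u1 u2 u3 : 0 <= u1 -> 0 <= u2 -> 0 <= u3 ->
  u1 * u2 * u3 <= ((u1 + u2 + u3) / 3) ^+ 3.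
Proof.
move=> h1 h2 h3.
(* Writing S for the sum and P for the product, S^3 - 27 P = 3 (k1 + k2 + k3) + (k4 + k5 + k6) / 2,
   each name standing for its nonnegative term. *)
have k1 : 0 <= u1 * (u2 - u3) ^+ 2 by rewrite mulr_ge0 ?sqr_ge0.
have k2 : 0 <= u2 * (u1 - u3) ^+ 2 by rewrite mulr_ge0 ?sqr_ge0.
have k3 : 0 <= u3 * (u1 - u2) ^+ 2 by rewrite mulr_ge0 ?sqr_ge0.
have k4 : 0 <= (u1 + u2 + u3) * (u1 - u2) ^+ 2 by rewrite mulr_ge0 ?sqr_ge0 ?addr_ge0.
have k5 : 0 <= (u1 + u2 + u3) * (u1 - u3) ^+ 2 by rewrite mulr_ge0 ?sqr_ge0 ?addr_ge0.
have k6 : 0 <= (u1 + u2 + u3) * (u2 - u3) ^+ 2 by rewrite mulr_ge0 ?sqr_ge0 ?addr_ge0.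
lra.
Qed.

Lemma prod3_le_cube u1 u2 u3 s : 0 <= u1 -> 0 <= u2 -> 0 <= u3 ->
  u1 + u2 + u3 <= s -> u1 * u2 * u3 <= (s / 3) ^+ 3.
Proof.
move=> h1 h2 h3 hs; apply: le_trans (amgm3 h1 h2 h3) _.
by rewrite lerXn2r ?nnegrE//; lra.
Qed.

Lemma prod3_le u1 u2 u3 : 0 <= u1 -> 0 <= u2 -> 0 <= u3 ->
  u1 + u2 + u3 <= 2 -> u1 * u2 * u3 <= 8 / 27.
Proof. by move=> h1 h2 h3 h; have := prod3_le_cube h1 h2 h3 h; lra. Qed.

(** For fixed u1 the product is largest when u2 and u3 share the remaining 2 - u1 equally. *)
Lemma prod3_le_sq u1 u2 u3 : 0 <= u1 -> 0 <= u2 -> 0 <= u3 ->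
  u1 + u2 + u3 <= 2 -> u1 * u2 * u3 <= u1 * (2 - u1) ^+ 2 / 4.
Proof.
move=> h1 h2 h3 hs.
have h : u2 * u3 <= (2 - u1) ^+ 2 / 4.
  have k : 0 <= (2 - u1 - u2 - u3) * (2 - u1 + u2 + u3) by apply: mulr_ge0; lra.
  by have := sqr_ge0 (u2 - u3); lra.
by have := ler_wpM2l h1 h; lra.
Qed.

(** With w = u2 + u3 the product is at most (2 - w) w^2 / 4, and (2 - w) w <= 1. The bound is linear
    in w, so the bounds of several corners can be added. *)
Lemma prod3_le_pairsum u1 u2 u3 : 0 <= u1 -> 0 <= u2 -> 0 <= u3 ->
  u1 + u2 + u3 <= 2 -> u1 * u2 * u3 <= (u2 + u3) / 4.
Proof.
move=> h1 h2 h3 hs.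
have h : u2 * u3 <= (u2 + u3) ^+ 2 / 4 by have := sqr_ge0 (u2 - u3); lra.
have k : u1 * (u2 * u3) <= (2 - (u2 + u3)) * ((u2 + u3) ^+ 2 / 4).
  by apply: ler_pM => //; [exact: mulr_ge0 | lra].
have : 0 <= (u2 + u3) * (u2 + u3 - 1) ^+ 2.
  by rewrite mulr_ge0 ?sqr_ge0 ?addr_ge0.
lra.
Qed.

(** 81/500 is the value at 1/5 of u (2 - u)^2 / 4, which increases on [0, 2/3]. The quadratic factor
    in the proof comes from dividing the difference of the two values by 1/5 - u1. *)
Lemma prod3_small u1 u2 u3 : 0 <= u1 -> 0 <= u2 -> 0 <= u3 ->
  u1 + u2 + u3 <= 2 -> u1 <= 1 / 5 -> u1 * u2 * u3 <= 81 / 500.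
Proof.
move=> h1 h2 h3 hs h; apply: le_trans (prod3_le_sq h1 h2 h3 hs) _.
have : 0 <= (1 / 5 - u1) * (u1 ^+ 2 - 19 / 5 * u1 + 81 / 25).
  apply: mulr_ge0; first lra.
  by have := sqr_ge0 u1; lra.
lra.
Qed.

(** Two linear bounds, of slopes 1/4 and 1/8, for u (2 - u)^2 / 4. The points 9/20 and 11/20 are
    close to those where this function has these slopes. *)
Lemma prod3_le_first u1 u2 u3 a : 0 <= u1 -> 0 <= u2 -> 0 <= u3 ->
  u1 + u2 + u3 <= 2 -> u1 <= a ->
  u1 * u2 * u3 <= 33 / 200 + a / 4 /\ u1 * u2 * u3 <= (1 + a / 2) / 4.
Proof.
move=> h1 h2 h3 hs h; have hB := prod3_le_sq h1 h2 h3 hs.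
have u2le : 0 <= 2 - u1 by lra.
have k1 := mulr_ge0 u2le (sqr_ge0 (u1 - 9 / 20)).
have k2 := mulr_ge0 u2le (sqr_ge0 (u1 - 11 / 20)).
have k3 := sqr_ge0 (u1 - 9 / 20); have k4 := sqr_ge0 (u1 - 11 / 20).
split; lra.
Qed.


(* (x, y, z) is not interior to twice the cuboctahedron. *)
Definition apart3 (x y z : R) := [\/ 2 <= `|x|, 2 <= `|y|, 2 <= `|z| | 4 <= `|x| + `|y| + `|z|].

Lemma apart3_ge0 (x y z : R) : 0 <= x ->
  apart3 x y z -> 2 <= x \/ 2 <= `|y| \/ 2 <= `|z| \/ 4 <= x + `|y| + `|z|.
Proof. by move=> x0; rewrite /apart3 (ger0_norm x0) => -[]; tauto. Qed.

(* The near translate is (2 + e, -a, -b) with a, b >= 0, and a partner in the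
   quadrant with signs (s2, s3) is (2 - u1, s2 (2 - u2), s3 (2 - u3)); the suffixes
   m and p of the lemma names give the signs s2 and s3. *)
Lemma near_mm e a b u1 u2 u3 : 0 <= e -> e <= 1 / 16 -> 0 <= a -> 0 <= b -> a < 2 -> b < 2 ->
  1 / 5 < u1 -> 1 / 5 < u2 -> 1 / 5 < u3 -> u1 + u2 + u3 <= 2 ->
  apart3 (e + u1) (2 - u2 - a) (2 - u3 - b) ->
  u2 + u3 <= 1 + (e - a - b) / 2.
Proof.
move=> e0 e16 a0 b0 a2 b2 h1 h2 h3 hs h; have eu : 0 <= e + u1 by lra.
(* e + u1 >= 2 is impossible, since u1 < 8/5 and e <= 1/16. With positive coordinate differences the
   sum condition, combined with u1 <= 2 - u2 - u3, is the claim; all other cases contradict the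
   bounds. *)
have {h} := apart3_ge0 eu h; case; first lra.
rewrite !ler_normr; case: (ler0P (2 - u2 - a)); case: (ler0P (2 - u3 - b)) => ? ?;
  by case=> [/orP[]|[/orP[]|]] ?; lra.
Qed.

(** In the second coordinate the partner and the near translate lie on opposite sides, at distance 2
    - u2 + a. This distance alone separates them if u2 <= a; otherwise the sum of the three
    distances has to. *)
Lemma near_pm e a b u1 u2 u3 : 0 <= e -> e <= 1 / 16 -> 0 <= a -> 0 <= b -> a < 2 -> b < 2 ->
  1 / 5 < u1 -> 1 / 5 < u2 -> 1 / 5 < u3 -> u1 + u2 + u3 <= 2 ->
  apart3 (e + u1) (2 - u2 + a) (2 - u3 - b) ->
  u2 <= a \/ u2 + u3 <= 1 + (e + a - b) / 2.
Proof.
move=> e0 e16 a0 b0 a2 b2 h1 h2 h3 hs h; have eu : 0 <= e + u1 by lra.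
have {h} := apart3_ge0 eu h; case; first lra.
have [?|?] := leP u2 a; first by left.
rewrite !ler_normr; case: (ler0P (2 - u2 + a)); case: (ler0P (2 - u3 - b)) => ? ?;
  by case=> [/orP[]|[/orP[]|]] ?; right; lra.
Qed.

Lemma near_pp e a b u1 u2 u3 : 0 <= e -> e <= 1 / 16 -> 0 <= a -> 0 <= b -> a < 2 -> b < 2 ->
  1 / 5 < u1 -> 1 / 5 < u2 -> 1 / 5 < u3 -> u1 + u2 + u3 <= 2 ->
  apart3 (e + u1) (2 - u2 + a) (2 - u3 + b) ->
  [\/ u2 <= a, u3 <= b | u2 + u3 <= 1 + (e + a + b) / 2].
Proof.
move=> e0 e16 a0 b0 a2 b2 h1 h2 h3 hs h; have eu : 0 <= e + u1 by lra.
have {h} := apart3_ge0 eu h; case; first lra.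
have [?|?] := leP u2 a; first by constructor 1.
have [?|?] := leP u3 b; first by constructor 2.
rewrite !ler_normr; case: (ler0P (2 - u2 + a)); case: (ler0P (2 - u3 + b)) => ? ?;
  by case=> [/orP[]|[/orP[]|]] ?; constructor 3; lra.
Qed.

(* B is the overlap u1 u2 u3 with a partner satisfying P, or 0 without a partner. *)
Definition corner_overlap (P : R -> R -> R -> Prop) (B : R) :=
  B = 0 \/ exists u1 u2 u3, [/\ [/\ 0 < u1, 0 < u2 & 0 < u3],
    u1 + u2 + u3 <= 2, B = u1 * u2 * u3 & P u1 u2 u3].

Lemma corner_overlap_le P B : corner_overlap P B -> B <= 8 / 27.
Proof.
case=> [->|[u1 [u2 [u3 [[? ? ?] ? -> _]]]]]; first lra.
by apply: prod3_le => //; exact: ltW.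
Qed.

Lemma corner_overlap_big P B : corner_overlap P B -> 81 / 500 < B ->
  exists u1 u2 u3, [/\ [/\ 1 / 5 < u1, 1 / 5 < u2 & 1 / 5 < u3],
    u1 + u2 + u3 <= 2, B = u1 * u2 * u3 & P u1 u2 u3].
Proof.
case=> [-> ?|[u1 [u2 [u3 [[h1 h2 h3] hs -> hP]]]] hB]; first lra.
have g1 := ltW h1; have g2 := ltW h2; have g3 := ltW h3.
exists u1, u2, u3; split=> //; split; rewrite ltNge; apply/negP => hu.
- by have := prod3_small g1 g2 g3 hs hu; lra.
- have hs' : u2 + u1 + u3 <= 2 by lra.
  by have := prod3_small g2 g1 g3 hs' hu; lra.
- have hs' : u3 + u1 + u2 <= 2 by lra.
  by have := prod3_small g3 g1 g2 hs' hu; lra.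
Qed.

Definition e_range e := 0 <= e /\ e <= 1 / 16.
Definition ab_range a := 0 <= a /\ a < 2.

Lemma corner_mm e a b B : e_range e -> ab_range a -> ab_range b ->
  corner_overlap (fun u1 u2 u3 => apart3 (e + u1) (2 - u2 - a) (2 - u3 - b)) B ->
  81 / 500 < B -> B <= (1 + (e - a - b) / 2) / 4.
Proof.
move=> [e0 e16] [a0 a2] [b0 b2] cB /(corner_overlap_big cB){cB}.
case=> u1 [u2 [u3 [[h1 h2 h3] hs -> hP]]].
have := near_mm e0 e16 a0 b0 a2 b2 h1 h2 h3 hs hP.
have k : 0 <= 1 / 5 :> R by lra.
have := prod3_le_pairsum (le_trans k (ltW h1)) (le_trans k (ltW h2)) (le_trans k (ltW h3)) hs.
by move: (u1 * u2 * u3) => B'; clear; lra.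
Qed.

Lemma corner_pm e a b B : e_range e -> ab_range a -> ab_range b ->
  corner_overlap (fun u1 u2 u3 => apart3 (e + u1) (2 - u2 + a) (2 - u3 - b)) B ->
  81 / 500 < B -> B <= 33 / 200 + a / 4 \/ B <= (1 + (e + a - b) / 2) / 4.
Proof.
move=> [e0 e16] [a0 a2] [b0 b2] cB /(corner_overlap_big cB){cB}.
case=> u1 [u2 [u3 [[h1 h2 h3] hs -> hP]]].
have k : 0 <= 1 / 5 :> R by lra.
have g1 := le_trans k (ltW h1); have g2 := le_trans k (ltW h2).
have g3 := le_trans k (ltW h3).
case: (near_pm e0 e16 a0 b0 a2 b2 h1 h2 h3 hs hP) => h; [left|right].
  have hs' : u2 + u1 + u3 <= 2 by rewrite (addrC u2).
  by have [+ _] := prod3_le_first g2 g1 g3 hs' h; rewrite (mulrC u2).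
have := prod3_le_pairsum g1 g2 g3 hs; move: h.
by move: (u1 * u2 * u3) => B'; clear; lra.
Qed.

(** In the two extra cases u2 <= a and u3 <= b the bound of slope 1/8 gives (1 + a/2)/4 or (1 +
    b/2)/4, so that one bound serves all three cases. *)
Lemma corner_pp e a b B : e_range e -> ab_range a -> ab_range b ->
  corner_overlap (fun u1 u2 u3 => apart3 (e + u1) (2 - u2 + a) (2 - u3 + b)) B ->
  81 / 500 < B -> B <= (1 + (e + a + b) / 2) / 4.
Proof.
move=> [e0 e16] [a0 a2] [b0 b2] cB /(corner_overlap_big cB){cB}.
case=> u1 [u2 [u3 [[h1 h2 h3] hs -> hP]]].
have k : 0 <= 1 / 5 :> R by lra.
have g1 := le_trans k (ltW h1); have g2 := le_trans k (ltW h2).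
have g3 := le_trans k (ltW h3).
case: (near_pp e0 e16 a0 b0 a2 b2 h1 h2 h3 hs hP) => h.
- have hs' : u2 + u1 + u3 <= 2 by rewrite (addrC u2).
  have [_] := prod3_le_first g2 g1 g3 hs' h; rewrite (mulrC u2); move: e0 b0.
  by move: (u1 * u2 * u3) => B'; clear; lra.
- have hs' : u3 + u1 + u2 <= 2 by rewrite -addrA addrC.
  have [_] := prod3_le_first g3 g1 g2 hs' h; rewrite -mulrA mulrC; move: e0 a0.
  by move: (u1 * u2 * u3) => B'; clear; lra.
- have := prod3_le_pairsum g1 g2 g3 hs; move: h.
  by move: (u1 * u2 * u3) => B'; clear; lra.
Qed.

(* Overlaps are at most (u2 + u3) / 4; the offsets a and b cancel in the sum of the
   four bounds on u2 + u3. A small overlap in one corner is enough by itself, since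
   the three others are at most 8/27. *)
Lemma near_sum e a b Bpp Bpm Bmp Bmm :
  e_range e -> ab_range a -> ab_range b ->
  corner_overlap (fun u1 u2 u3 => apart3 (e + u1) (2 - u2 + a) (2 - u3 + b)) Bpp ->
  corner_overlap (fun u1 u2 u3 => apart3 (e + u1) (2 - u2 + a) (2 - u3 - b)) Bpm ->
  corner_overlap (fun u1 u2 u3 => apart3 (e + u1) (2 - u2 - a) (2 - u3 + b)) Bmp ->
  corner_overlap (fun u1 u2 u3 => apart3 (e + u1) (2 - u2 - a) (2 - u3 - b)) Bmm ->
  Bpp + Bpm + Bmp + Bmm <= 132 / 125.
Proof.
move=> re ra rb cpp cpm cmp cmm.
have lpp := corner_overlap_le cpp; have lpm := corner_overlap_le cpm.
have lmp := corner_overlap_le cmp; have lmm := corner_overlap_le cmm.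
rewrite leNgt; apply/negP => big.
have gpp : 81 / 500 < Bpp by lra.
have gpm : 81 / 500 < Bpm by lra.
have gmp : 81 / 500 < Bmp by lra.
have gmm : 81 / 500 < Bmm by lra.
(* Exchanging the last two coordinates turns this corner into the preceding kind, with a and b
   exchanged. *)
have cpm' : corner_overlap (fun u1 u2 u3 =>
    apart3 (e + u1) (2 - u2 + b) (2 - u3 - a)) Bmp.
  case: cmp => [->|[u1 [u2 [u3 [[? ? ?] hs -> hP]]]]]; first by left.
  right; exists u1, u3, u2; split=> //.
  - by rewrite addrAC.
  - by rewrite mulrAC.
  - by case: hP => h; [constructor 1|constructor 3|constructor 2|constructor 4; rewrite addrAC].
have := corner_mm re ra rb cmm gmm; have := corner_pp re ra rb cpp gpp.
have := corner_pm re ra rb cpm gpm; have := corner_pm re rb ra cpm' gmp.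
move: re ra rb big lpp lpm lmp lmm gpp gpm gmp gmm; rewrite /e_range /ab_range; clear.
(* If all four bounds are of the form (1 + ...)/4, they sum to 1 + e/2. For the bounds 33/200 + a/4
   and 33/200 + b/4, the inequality 81/500 < Bmm is used: it forces a + b < e + 88/125. *)
by move=> [_ ?] [? _] [? _] ? ? ? ? ? ? ? ? ? [] ? [] ? ? ?; lra.
Qed.

End Corner.

(** * The covering by prisms *)

Section Boxes.
Variable R : realType.
Implicit Types (p q x y lo hi : space3 R).

Definition pt a b c : space3 R := (a, b, c).

Definition box lo hi : set (space3 R) :=
  (`]lo.1.1, hi.1.1] `*` `]lo.1.2, hi.1.2]) `*` `]lo.2, hi.2].

Definition box_vol lo hi : R :=
  (hi.1.1 - lo.1.1) * (hi.1.2 - lo.1.2) * (hi.2 - lo.2).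

Definition box_le lo hi := [/\ lo.1.1 <= hi.1.1, lo.1.2 <= hi.1.2 & lo.2 <= hi.2].

Lemma boxP lo hi p : box lo hi p <->
  [/\ lo.1.1 < p.1.1 <= hi.1.1, lo.1.2 < p.1.2 <= hi.1.2 & lo.2 < p.2 <= hi.2].
Proof.
by rewrite /box; split => [[[]]|[]] /=; rewrite !in_itv /=.
Qed.

Lemma measurable_box lo hi : measurable (box lo hi).
Proof. by apply: measurableX => //; apply: measurableX. Qed.

End Boxes.


(** * Partners in one quadrant *)

Section Quadrant.
Variable R : realType.
Implicit Types (x y p t : space3 R) (Y : seq (space3 R)) (s : bool).

Definition prism x : set (space3 R) :=
  box (x - pt 1 1 1) (x + pt (17/16) 1 1).

Definition prisms Y : set (space3 R) := [set p | exists2 y, y \in Y & prism y p].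

Definition apart x y := apart3 (y.1.1 - x.1.1) (y.1.2 - x.1.2) (y.2 - x.2).

Lemma prismP x p : prism x p <-> [/\ x.1.1 - 1 < p.1.1 <= x.1.1 + 17 / 16,
  x.1.2 - 1 < p.1.2 <= x.1.2 + 1 & x.2 - 1 < p.2 <= x.2 + 1].
Proof. exact: boxP. Qed.

Definition sg (s : bool) : R := if s then 1 else -1.

Definition partner s2 s3 x y :=
  [/\ y.1.1 - x.1.1 < 2, 0 < sg s2 * (y.1.2 - x.1.2) < 2 &
      0 < sg s3 * (y.2 - x.2) < 2].

Lemma partner_sum s2 s3 x y : x.1.1 <= y.1.1 -> partner s2 s3 x y -> apart x y ->
  4 <= (y.1.1 - x.1.1) + sg s2 * (y.1.2 - x.1.2) + sg s3 * (y.2 - x.2).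
Proof.
rewrite /partner => h [h1 /andP[h2 h3] /andP[h4 h5]].
have k : 0 <= y.1.1 - x.1.1 by lra.
move/(apart3_ge0 k).
have e2 : `|y.1.2 - x.1.2| = sg s2 * (y.1.2 - x.1.2).
  by case: s2 h2 h3; rewrite /sg => ? ?; [rewrite ger0_norm|rewrite ler0_norm]; lra.
have e3 : `|y.2 - x.2| = sg s3 * (y.2 - x.2).
  by case: s3 h4 h5 {e2}; rewrite /sg => ? ?; [rewrite ger0_norm|rewrite ler0_norm]; lra.
by rewrite e2 e3; case=> [|[|[]]]; lra.
Qed.

(** Up to signs, both differences to x have coordinates v, v' in [0, 2) with sum at least 4. Since
    |v' - v| < 4 - v - v' in each coordinate, the three distances between y and y' sum to less than
    12 - 8 = 4, and each is below 2. *)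
Lemma partner_uniq s2 s3 x y y' : x.1.1 <= y.1.1 -> x.1.1 <= y'.1.1 ->
  partner s2 s3 x y -> partner s2 s3 x y' ->
  apart x y -> apart x y' -> ~ apart y y'.
Proof.
move=> h h' c c' a a'.
have k := partner_sum h c a; have k' := partner_sum h' c' a'.
move: c c' => [h1 /andP[h2 h3] /andP[h4 h5]] [h1' /andP[h2' h3'] /andP[h4' h5']].
have k0 : 0 <= y.1.1 - x.1.1 by lra.
have k0' : 0 <= y'.1.1 - x.1.1 by lra.
have dist_lt (v v' : R) : 0 <= v < 2 -> 0 <= v' < 2 ->
    `|v' - v| < 4 - v - v' /\ `|v' - v| < 2.
  by move=> ? ?; split; rewrite ltr_norml; lra.
have sgM s (v v' w : R) : `|v' - v| = `|sg s * (v' - w) - sg s * (v - w)|.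
  by case: s; rewrite /sg -mulrBr normrM ?normrN normr1 mul1r; congr `|_|; ring.
rewrite /apart /apart3 (sgM s2 y.1.2 y'.1.2 x.1.2) (sgM s3 y.2 y'.2 x.2).
have -> : y'.1.1 - y.1.1 = (y'.1.1 - x.1.1) - (y.1.1 - x.1.1) by ring.
have [|| l1 m1] := dist_lt (y.1.1 - x.1.1) (y'.1.1 - x.1.1); [lra..|].
have [|| l2 m2] := dist_lt (sg s2 * (y.1.2 - x.1.2)) (sg s2 * (y'.1.2 - x.1.2)); [lra..|].
have [|| l3 m3] := dist_lt (sg s3 * (y.2 - x.2)) (sg s3 * (y'.2 - x.2)); [lra..|].
move: l1 m1 l2 m2 l3 m3.
set d1 := `|_ - (y.1.1 - _)|; set d2 := `|_ - _ * (y.1.2 - _)|; set d3 := `|_ - _ * (y.2 - _)|.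
move=> l1 m1 l2 m2 l3 m3; case=> ?.
- by move: m1; rewrite ltNge => /negP.
- by move: m2; rewrite ltNge => /negP.
- by move: m3; rewrite ltNge => /negP.
- lra.
Qed.

Lemma sg_norm d : sg (0 < d) * d = `|d|.
Proof. by case: (ltrP 0 d) => [/gtr0_norm ->|/ler0_norm ->]; rewrite /sg ?mul1r ?mulN1r. Qed.

(** Meeting prisms have side offsets below 2 and a height difference below 33/16. If the latter is
    also below 2, only the sum condition is left, and it forces every offset to be nonzero. *)
Lemma prism_meet x y p : x.1.1 <= y.1.1 -> apart x y -> prism x p -> prism y p ->
  [/\ 2 <= y.1.1 - x.1.1 <= 2 + 1 / 16, `|y.1.2 - x.1.2| < 2 & `|y.2 - x.2| < 2] \/
  exists s2 s3, partner s2 s3 x y.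
Proof.
move=> h a /prismP[/andP[p1 p2] /andP[p3 p4] /andP[p5 p6]].
move=> /prismP[/andP[q1 q2] /andP[q3 q4] /andP[q5 q6]].
have n2 : `|y.1.2 - x.1.2| < 2 by rewrite ltr_norml; lra.
have n3 : `|y.2 - x.2| < 2 by rewrite ltr_norml; lra.
have [k|k] := leP 2 (y.1.1 - x.1.1); first by left; split => //; lra.
right; have k0 : 0 <= y.1.1 - x.1.1 by lra.
exists (x.1.2 < y.1.2), (x.2 < y.2).
move/(apart3_ge0 k0): a; move: n2 n3.
rewrite /partner.
have -> : (x.1.2 < y.1.2) = (0 < y.1.2 - x.1.2) by rewrite subr_gt0.
have -> : (x.2 < y.2) = (0 < y.2 - x.2) by rewrite subr_gt0.
rewrite !sg_norm; move: k; move: (_ - _) `|_| `|_| => d1 d2 d3; clear=> ? ? ?.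
by case=> [|[|[|?]]]; [lra|lra|lra|split; lra].
Qed.

(** For x below y and y in the quadrant of s2 and s3, these are the ends of the common part of the
    two prisms up to height [x.1.1 + h]: all of it for h = 17/16, the part inside the cube around x
    for h = 1. *)
Definition overlap_lo s2 s3 x y : space3 R :=
  pt (y.1.1 - 1) (if s2 then y.1.2 - 1 else x.1.2 - 1) (if s3 then y.2 - 1 else x.2 - 1).
Definition overlap_hi s2 s3 x y (h : R) : space3 R :=
  pt (x.1.1 + h) (if s2 then x.1.2 + 1 else y.1.2 + 1) (if s3 then x.2 + 1 else y.2 + 1).

Lemma overlap_vol s2 s3 x y h : box_vol (overlap_lo s2 s3 x y) (overlap_hi s2 s3 x y h) =
  (2 - (y.1.1 - x.1.1) + (h - 1)) * (2 - sg s2 * (y.1.2 - x.1.2)) *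
  (2 - sg s3 * (y.2 - x.2)).
Proof. by rewrite /box_vol; case: s2 s3 => -[]; rewrite /= /sg; ring. Qed.

Lemma overlap_le s2 s3 x y h : partner s2 s3 x y -> 1 <= h ->
  box_le (overlap_lo s2 s3 x y) (overlap_hi s2 s3 x y h).
Proof.
move=> [h1 /andP[_ h2] /andP[_ h3]] k; split; rewrite /=; first lra.
  by case: s2 h2; rewrite /sg; clear; lra.
by case: s3 h3; rewrite /sg; clear; lra.
Qed.

Lemma overlap_cover s2 s3 x y h p : prism x p -> prism y p -> p.1.1 <= x.1.1 + h ->
  box (overlap_lo s2 s3 x y) (overlap_hi s2 s3 x y h) p.
Proof.
move=> /prismP[_ /andP[p3 p4] /andP[p5 p6]].
move=> /prismP[/andP[q1 _] /andP[q3 q4] /andP[q5 q6]] ph; apply/boxP.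
by split; rewrite /= ?q1 ?ph//; [case: s2|case: s3]; apply/andP.
Qed.

(** As there is at most one partner, a single box contains all overlaps in the quadrant. The box up
    to [hi] is used when no translate is near, the box up to [hi'], confined to the cube around x,
    when one is. *)
Lemma quadrant_overlap s2 s3 x Y :
  (forall y, y \in Y -> x.1.1 <= y.1.1 /\ apart x y) ->
  (forall y y', y \in Y -> y' \in Y -> y != y' -> apart y y') ->
  exists lo hi hi' B, [/\
   [/\ box_le lo hi, box_vol lo hi <= 1331 / 4096,
    box_le lo hi' & box_vol lo hi' = B],
   (forall y p, y \in Y -> partner s2 s3 x y -> prism x p -> prism y p -> box lo hi p),
   (forall y p, y \in Y -> partner s2 s3 x y -> prism x p -> prism y p ->
      p.1.1 <= x.1.1 + 1 -> box lo hi' p) &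
   corner_overlap (fun u1 u2 u3 => exists2 y, y \in Y &
     [/\ y.1.1 - x.1.1 = 2 - u1, y.1.2 - x.1.2 = sg s2 * (2 - u2) &
       y.2 - x.2 = sg s3 * (2 - u3)]) B].
Proof.
move=> hY aY.
have [[y [yY py]]|no] := pselect (exists y, y \in Y /\ partner s2 s3 x y); last first.
  (* Without a partner the boxes degenerate to empty ones of volume 0. *)
  exists x, x, x, 0; split; last by left.
  - have b0 : box_le x x by split.
    have v0 : box_vol x x = 0 by rewrite /box_vol !subrr !mulr0.
    by split=> //; rewrite v0; clear; lra.
  - by move=> y p yY py; exfalso; apply: no; exists y.
  - by move=> y p yY py; exfalso; apply: no; exists y.
have [h a] := hY _ yY.
have only y' : y' \in Y -> partner s2 s3 x y' -> y' = y.
  move=> y'Y py'; apply: contrapT => /eqP ne.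
  have [h' a'] := hY _ y'Y.
  by apply: (partner_uniq h' h py' py a' a); exact: aY.
have sum4 := partner_sum h py a.
have [h1 /andP[h2 h3] /andP[h4 h5]] := py.
exists (overlap_lo s2 s3 x y), (overlap_hi s2 s3 x y (17/16)), (overlap_hi s2 s3 x y 1).
eexists; split; [split|..].
- by apply: overlap_le => //; clear; lra.
- rewrite overlap_vol.
  (* The sides are u1 + 1/16, u2 and u3, of sum at most 2 + 1/16, hence the cube of 11/16. *)
  have -> : 1331 / 4096 = ((2 + 1 / 16) / 3) ^+ 3 :> R by clear; lra.
  move: sum4 h1 h2 h3 h4 h5; move: (_ - _) (sg s2 * _) (sg s3 * _) => d1 d2 d3.
  by clear=> ? ? ? ? ? ?; apply: prod3_le_cube; lra.
- exact: overlap_le.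
- by rewrite overlap_vol subrr addr0.
- move=> y' p y'Y py'; rewrite (only _ y'Y py') => xp yp; apply: overlap_cover => //.
  by move/prismP: xp => [/andP[]].
- by move=> y' p y'Y py'; rewrite (only _ y'Y py') => xp yp; exact: overlap_cover.
- right; exists (2 - (y.1.1 - x.1.1)), (2 - sg s2 * (y.1.2 - x.1.2)).
  exists (2 - sg s3 * (y.2 - x.2)); split => //.
  + move: h1 h2 h3 h4 h5; move: (_ - _) (sg s2 * _) (sg s3 * _) => d1 d2 d3.
    by clear=> *; split; lra.
  + move: sum4; move: (_ - _) (sg s2 * _) (sg s3 * _) => d1 d2 d3.
    by clear=> *; lra.
  + have sgK s (d : R) : sg s * (sg s * d) = d.
      by case: s; rewrite /sg ?mul1r ?mulN1r ?mulrN ?mul1r ?opprK.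
    by exists y => //; rewrite !subKr !sgK.
Qed.

End Quadrant.

(** * Measure of a union of prisms *)

Section PrismMeasure.
Variable R : realType.
Implicit Types (x y p t : space3 R) (Y : seq (space3 R)) (s : bool).

Lemma prisms_nil : prisms [::] = set0 :> set (space3 R).
Proof. by rewrite -subset0 => p []. Qed.

Lemma prisms_cons y Y : prisms (y :: Y) = prism y `|` prisms Y.
Proof.
apply/seteqP; split => p /=.
  by case=> z; rewrite inE => /predU1P[->|zY zp]; [left|right; exists z].
by case=> [yp|[z zY zp]]; [exists y; rewrite ?mem_head|exists z; rewrite ?inE ?zY ?orbT].
Qed.

Lemma measurable_prism y : measurable (prism y).
Proof. exact: measurable_box. Qed.

Lemma measurable_prisms Y : measurable (prisms Y).
Proof.
elim: Y => [|y Y IH]; first by rewrite prisms_nil.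
by rewrite prisms_cons; apply: measurableU => //; exact: measurable_prism.
Qed.

Lemma corner_overlap_impl (P Q : R -> R -> R -> Prop) B :
  (forall u1 u2 u3, 0 < u1 -> P u1 u2 u3 -> Q u1 u2 u3) ->
  corner_overlap P B -> corner_overlap Q B.
Proof.
move=> PQ [->|[u1 [u2 [u3 [[h1 h2 h3] hs hB hP]]]]]; [by left|right].
by exists u1, u2, u3; split=> //; exact: PQ.
Qed.

Lemma near_corner x y Y (s2 s3 : bool) B :
  y \in Y -> 2 <= y.1.1 - x.1.1 ->
  (forall y y', y \in Y -> y' \in Y -> y != y' -> apart y y') ->
  corner_overlap (fun u1 u2 u3 => exists2 y, y \in Y &
     [/\ y.1.1 - x.1.1 = 2 - u1, y.1.2 - x.1.2 = sg R s2 * (2 - u2) &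
       y.2 - x.2 = sg R s3 * (2 - u3)]) B ->
  corner_overlap (fun u1 u2 u3 => apart3 (y.1.1 - x.1.1 - 2 + u1)
    (2 - u2 + - sg R s2 * (y.1.2 - x.1.2)) (2 - u3 + - sg R s3 * (y.2 - x.2))) B.
Proof.
move=> yY hy aY; apply: corner_overlap_impl => u1 u2 u3 u1p [z zY [e1 e2 e3]].
(* A partner is less than 2 above x and the near translate at least 2, so they are distinct and
   hence apart. *)
have zy : z != y by apply/eqP => zy; move: e1 hy u1p; rewrite zy; clear; lra.
have := aY _ _ zY yY zy; rewrite /apart.
have -> : y.1.1 - z.1.1 = y.1.1 - x.1.1 - 2 + u1 by move: e1; clear; lra.
have sgE s d (u : R) : `|d - sg R s * (2 - u)| = `|2 - u + - sg R s * d|.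
  by rewrite distrC; case: s; rewrite /sg ?mul1r ?mulN1r// -normrN; congr `|_|; ring.
have -> : y.1.2 - z.1.2 = (y.1.2 - x.1.2) - (z.1.2 - x.1.2) by ring.
have -> : y.2 - z.2 = (y.2 - x.2) - (z.2 - x.2) by ring.
by rewrite e2 e3 /apart3 !sgE.
Qed.

(** Reflecting the last two coordinates makes the offsets |d2| and |d3|; this permutes the four
    corners and reduces every sign pattern to [near_sum]. *)
Lemma near_sum_signs (d1 d2 d3 B1 B2 B3 B4 : R) :
  2 <= d1 -> d1 <= 2 + 1 / 16 -> `|d2| < 2 -> `|d3| < 2 ->
  corner_overlap (fun u1 u2 u3 => apart3 (d1 - 2 + u1) (2 - u2 - d2) (2 - u3 - d3)) B1 ->
  corner_overlap (fun u1 u2 u3 => apart3 (d1 - 2 + u1) (2 - u2 - d2) (2 - u3 + d3)) B2 ->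
  corner_overlap (fun u1 u2 u3 => apart3 (d1 - 2 + u1) (2 - u2 + d2) (2 - u3 - d3)) B3 ->
  corner_overlap (fun u1 u2 u3 => apart3 (d1 - 2 + u1) (2 - u2 + d2) (2 - u3 + d3)) B4 ->
  B1 + (B2 + (B3 + B4)) <= 132 / 125.
Proof.
move=> d1l d1u d2l d3l c1 c2 c3 c4.
have re : e_range (d1 - 2) by split; move: d1l d1u; clear; lra.
have rng (d : R) : `|d| < 2 -> ab_range `|d| by [].
have ra := rng _ d2l; have rb := rng _ d3l.
rewrite !addrA; move: ra rb.
case: (ler0P d2) => s2; case: (ler0P d3) => s3 ra rb.
- have : B1 + B2 + B3 + B4 <= 132 / 125.
    by apply: (near_sum re ra rb); [move: c1|move: c2|move: c3|move: c4]; apply: corner_overlap_impl => u1 u2 u3 _;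
      rewrite ?opprK.
  by clear; lra.
- have : B2 + B1 + B4 + B3 <= 132 / 125.
    by apply: (near_sum re ra rb); [move: c2|move: c1|move: c4|move: c3]; apply: corner_overlap_impl => u1 u2 u3 _;
      rewrite ?opprK.
  by clear; lra.
- have : B3 + B4 + B1 + B2 <= 132 / 125.
    by apply: (near_sum re ra rb); [move: c3|move: c4|move: c1|move: c2]; apply: corner_overlap_impl => u1 u2 u3 _;
      rewrite ?opprK.
  by clear; lra.
- have : B4 + B3 + B2 + B1 <= 132 / 125.
    by apply: (near_sum re ra rb); [move: c4|move: c3|move: c2|move: c1]; apply: corner_overlap_impl => u1 u2 u3 _;
      rewrite ?opprK.
  by clear; lra.
Qed.

Variables (m : {measure set (space3 R) -> \bar R}) (c : R).
Hypothesis c_ge0 : 0 <= c.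
Hypothesis m_box : forall lo hi : space3 R, box_le lo hi ->
  m (box lo hi) = (c * box_vol lo hi)%:E.

Lemma measure_prism x : m (prism x) = (c * (33 / 4))%:E.
Proof.
rewrite m_box; last by split; rewrite /=; lra.
by congr (_ * _)%:E; rewrite /box_vol /=; lra.
Qed.

Lemma measure_cover5 (S A1 A2 A3 A4 A5 : set (space3 R)) (r1 r2 r3 r4 r5 : R) :
  measurable S -> measurable A1 -> measurable A2 -> measurable A3 ->
  measurable A4 -> measurable A5 ->
  m A1 = r1%:E -> m A2 = r2%:E -> m A3 = r3%:E -> m A4 = r4%:E -> m A5 = r5%:E ->
  S `<=` A1 `|` (A2 `|` (A3 `|` (A4 `|` A5))) ->
  (m S <= (r1 + (r2 + (r3 + (r4 + r5))))%:E)%E.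
Proof.
move=> mS m1 m2 m3 m4 m5 e1 e2 e3 e4 e5 SA.
have m45 := measurableU _ _ m4 m5; have m345 := measurableU _ _ m3 m45.
have m2345 := measurableU _ _ m2 m345.
apply: le_trans (le_measure m _ _ SA) _; rewrite ?inE//; first exact: measurableU.
rewrite !EFinD -e1 -e2 -e3 -e4 -e5.
apply: le_trans (measureU2 _ m1 m2345) _; apply: leeD => //.
apply: le_trans (measureU2 _ m2 m345) _; apply: leeD => //.
apply: le_trans (measureU2 _ m3 m45) _; apply: leeD => //.
exact: measureU2.
Qed.

Definition cap x : set (space3 R) := box (x + pt 1 (-1) (-1)) (x + pt (17/16) 1 1).

Lemma prism_overlap x Y :
  (forall y, y \in Y -> x.1.1 <= y.1.1 /\ apart x y) ->
  (forall y y', y \in Y -> y' \in Y -> y != y' -> apart y y') ->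
  (m (prism x `&` prisms Y) <= (c * (1 / 4 + 132 / 125))%:E)%E.
Proof.
move=> xY aY.
have mS : measurable (prism x `&` prisms Y).
  by apply: measurableI; [exact: measurable_prism|exact: measurable_prisms].
have [l1 [h1 [k1 [B1 [[w1 v1 z1 o1] f1 g1 c1]]]]] := quadrant_overlap true true xY aY.
have [l2 [h2 [k2 [B2 [[w2 v2 z2 o2] f2 g2 c2]]]]] := quadrant_overlap true false xY aY.
have [l3 [h3 [k3 [B3 [[w3 v3 z3 o3] f3 g3 c3]]]]] := quadrant_overlap false true xY aY.
have [l4 [h4 [k4 [B4 [[w4 v4 z4 o4] f4 g4 c4]]]]] := quadrant_overlap false false xY aY.
have [[y [yY /andP[y1 y1'] y2 y3]]|far] := pselect (exists y, [/\ y \in Y,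
    2 <= y.1.1 - x.1.1 <= 2 + 1 / 16, `|y.1.2 - x.1.2| < 2 & `|y.2 - x.2| < 2]).
- have capE : m (cap x) = (c * (1 / 4))%:E.
    rewrite m_box; last by split; rewrite /=; lra.
    by congr (_ * _)%:E; rewrite /box_vol /=; lra.
  have e1 := m_box z1; have e2 := m_box z2; have e3 := m_box z3; have e4 := m_box z4.
  apply: (@le_trans _ _ (c * (1 / 4) + (c * box_vol l1 k1 + (c * box_vol l2 k2 +
      (c * box_vol l3 k3 + c * box_vol l4 k4))))%:E).
    apply: measure_cover5 mS _ _ _ _ _ capE e1 e2 e3 e4 _; rewrite /cap; try exact: measurable_box.
    move=> p [xp [z zY zp]].
    have [p1|p1] := ltP (x.1.1 + 1) p.1.1.
      left; move/prismP: xp => [/andP[_ xp1] xp2 xp3].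
      by apply/boxP; split; rewrite /= ?p1.
    right; have [xz az] := xY _ zY.
    (* The prism of a near translate starts at height at least [x.1.1 + 1], so below the cap only
       partners cover. *)
    have [[/andP[n1 _] _ _]|[s2 [s3 pz]]] := prism_meet xz az xp zp.
      move/prismP: zp => [/andP[zp _] _ _].
      by exfalso; move: zp n1 p1; lra.
    case: s2 s3 pz => -[] pz.
    + by left; exact: g1 pz xp zp p1.
    + by right; left; exact: g2 pz xp zp p1.
    + by right; right; left; exact: g3 pz xp zp p1.
    + by right; right; right; exact: g4 pz xp zp p1.
  rewrite lee_fin o1 o2 o3 o4 -!mulrDr ler_wpM2l// lerD2l.
  by apply: (near_sum_signs y1 y1' y2 y3);
    [move: c1|move: c2|move: c3|move: c4] => /(near_corner yY y1 aY);
    apply: corner_overlap_impl => u1 u2 u3 _; rewrite /sg ?opprK ?mulN1r ?mul1r.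
- have e1 := m_box w1; have e2 := m_box w2; have e3 := m_box w3; have e4 := m_box w4.
  apply: (@le_trans _ _ (0 + (c * box_vol l1 h1 + (c * box_vol l2 h2 +
      (c * box_vol l3 h3 + c * box_vol l4 h4))))%:E).
    apply: measure_cover5 mS _ _ _ _ _ (measure0 m) e1 e2 e3 e4 _; rewrite ?set0U; try exact: measurable_box; try by [].
    move=> p [xp [z zY zp]]; have [xz az] := xY _ zY.
    have [[n1 n2 n3]|[s2 [s3 pz]]] := prism_meet xz az xp zp.
      by exfalso; apply: far; exists z.
    case: s2 s3 pz => -[] pz.
    + by left; exact: f1 pz xp zp.
    + by right; left; exact: f2 pz xp zp.
    + by right; right; left; exact: f3 pz xp zp.
    + by right; right; right; exact: f4 pz xp zp.
  rewrite lee_fin add0r -!mulrDr ler_wpM2l//.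
  (* 4 (11/16)^3 = 1331/1024 is just below 1/4 + 132/125. *)
  by move: v1 v2 v3 v4; lra.
Qed.

(* Adding the prisms in order of decreasing first coordinate, each new one
   only meets prisms lying above it. *)
Lemma measure_prisms_ge Y : uniq Y ->
  (forall y y', y \in Y -> y' \in Y -> y != y' -> apart y y') ->
  (((size Y)%:R * (c * (868 / 125)))%:E <= m (prisms Y))%E.
Proof.
wlog: Y / sorted (fun x y => x.1.1 <= y.1.1) Y => [wl uY aY|].
  have tot : total (fun x y : space3 R => x.1.1 <= y.1.1) by move=> x y; exact: le_total.
  have := wl (sort (fun x y => x.1.1 <= y.1.1) Y) (sort_sorted tot Y).
  rewrite sort_uniq size_sort => /(_ uY) h.
  have -> : prisms Y = prisms (sort (fun x y => x.1.1 <= y.1.1) Y).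
    by apply/seteqP; split => p [y yY yp]; exists y; move: yY; rewrite // mem_sort.
  by apply: h => y y'; rewrite !mem_sort; exact: aY.
elim: Y => [|x Y IH] srt uY aY; first by rewrite mul0r prisms_nil measure0.
move: uY => /= /andP[xY uY].
have tr : transitive (fun x y : space3 R => x.1.1 <= y.1.1).
  by move=> y x' z; exact: le_trans.
have {}IH : (((size Y)%:R * (c * (868 / 125)))%:E <= m (prisms Y))%E.
  apply: IH => //; first exact: path_sorted srt.
  by move=> y y' yY y'Y; apply: aY; rewrite inE (yY, y'Y) orbT.
have low y : y \in Y -> x.1.1 <= y.1.1 /\ apart x y.
  move=> yY; split; first by move: srt => /= /(order_path_min tr)/allP/(_ _ yY).
  by apply: aY; rewrite ?mem_head ?inE ?yY ?orbT//; apply: contraNneq xY => ->.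
have ov := prism_overlap low (fun y y' yY y'Y =>
  aY y y' (mem_behead (s := x :: Y) yY) (mem_behead (s := x :: Y) y'Y)).
rewrite prisms_cons measureUfinl; [|exact: measurable_prism|exact: measurable_prisms|]; last first.
  by rewrite measure_prism ltry.
rewrite measure_prism -addeA.
have ovf : (m (prism x `&` prisms Y) \is a fin_num)%E.
  by rewrite ge0_fin_numE// (le_lt_trans ov)// ltry.
rewrite -(fineK ovf) in ov *; rewrite lee_fin in ov.
apply: (@le_trans _ _ ((c * (33 / 4))%:E + (((size Y)%:R * (c * (868 / 125)))%:E -
    (c * (1 / 4 + 132 / 125))%:E))%E); last first.
  by apply: leeD => //; apply: leeB => //; rewrite lee_fin.
rewrite -EFinB -EFinD lee_fin -natr1 mulrDl mul1r.
by lra.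
Qed.

End PrismMeasure.

(** * Measures scaling like the volume *)

Section ImageMeasure.
Context d d' (T1 : measurableType d) (T2 : measurableType d') (R : realType).
Variables (m : {measure set T1 -> \bar R}) (f : T1 -> T2).
Hypothesis mf : measurable_fun [set: T1] f.

Definition image_measure : {measure set T2 -> \bar R} :=
  measure_function_pushforward__canonical__measure_function_Measure m mf.

Lemma measurable_preimage A : measurable A -> measurable (f @^-1` A).
Proof. by move=> mA; rewrite -[X in measurable X]setTI; exact: mf. Qed.
End ImageMeasure.

Section AffineVolume.
Variable R : realType.

Definition affine1 (k b : R) (x : R) := k * x + b.

Lemma measurable_affine1 k b : measurable_fun [set: R] (affine1 k b).
Proof. by apply: measurable_realfun.measurable_funD => //; exact: measurable_realfun.measurable_funM. Qed.

Lemma preimage_affine1_itv k b (a c : R) : k != 0 ->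
  lebesgue_measure (affine1 k b @^-1` `]a, c]) =
  (`|k|^-1%:E * lebesgue_measure `]a, c]%classic)%E.
Proof.
move=> k0; rewrite lebesgue_measure_itv /= lte_fin.
have [kp|kn] := ltP 0 k.
  have -> : affine1 k b @^-1` `]a, c] = `](a - b) / k, (c - b) / k]%classic.
    apply/seteqP; split => x; rewrite /affine1 /= !in_itv /=;
    by rewrite ltr_pdivrMr// ler_pdivlMr// ltrBlDr lerBrDr (mulrC x).
  rewrite lebesgue_measure_itv /= lte_fin gtr0_norm// ltr_pM2r ?invr_gt0// ltrD2r.
  case: ifP => _; last by rewrite mule0.
  by rewrite -EFinB -mulrBl -!EFinB -EFinM mulrC; congr (_ * _)%:E; ring.
have {}kn : k < 0 by rewrite lt_neqAle k0.
(* A negative slope reverses the interval, so the included end changes side. *)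
have -> : affine1 k b @^-1` `]a, c] = `[(c - b) / k, (a - b) / k[%classic.
  apply/seteqP; split => x; rewrite /affine1 /= !in_itv /=;
  by rewrite ler_ndivrMr// ltr_ndivlMr// ltrBlDr lerBrDr (mulrC x) andbC.
rewrite lebesgue_measure_itv /= lte_fin ltr0_norm// ltr_nM2r ?invr_lt0// ltrD2r.
case: ifP => _; last by rewrite mule0.
by rewrite -!EFinB -mulrBl -EFinM mulrC invrN mulNr -mulrN; congr (_ * _)%:E; ring.
Qed.

(** The image measure multiplied by |k| agrees with Lebesgue measure on half-open intervals, hence
    everywhere by uniqueness. *)
Lemma lebesgue_measure_affine1 k b (A : set R) : k != 0 -> measurable A ->
  lebesgue_measure (affine1 k b @^-1` A) = (`|k|^-1%:E * lebesgue_measure A)%E.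
Proof.
move=> k0 mA.
have kE : (`|k|^-1%:E * `|k|%:E = 1 :> \bar R)%E.
  by rewrite -EFinM mulVf// normr_eq0.
have k_ge0 : 0 <= `|k| by [].
pose mu : {measure set (measurableTypeR R) -> \bar R} :=
  mscale (NngNum k_ge0) (@image_measure _ _ _ (measurableTypeR R) R lebesgue_measure
    (affine1 k b) (measurable_affine1 k b)).
rewrite [in RHS](lebesgue_measure_unique (mu := mu)) => //.
  by rewrite /mu /= /mscale /= muleA kE mul1e.
move=> _ [[a c] _ <-]; rewrite /mu /= /mscale /= /pushforward.
by rewrite preimage_affine1_itv// muleA (muleC `|k|%:E) kE mul1e.
Qed.

(** The product measure integrates the measures of sections: [f2] rescales each section by [a2], and
    the substitution [f1] rescales the integral by [a1]. *)
Lemma product_measure_preimage d1 d2 (T1 : measurableType d1) (T2 : measurableType d2)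
  (m1 : {measure set T1 -> \bar R}) (m2 : {sigma_finite_measure set T2 -> \bar R})
  (f1 : T1 -> T1) (f2 : T2 -> T2) (a1 a2 : R) :
  0 <= a1 -> 0 <= a2 -> measurable_fun setT f1 ->
  (forall A, measurable A -> m1 (f1 @^-1` A) = (a1%:E * m1 A)%E) ->
  (forall A, measurable A -> m2 (f2 @^-1` A) = (a2%:E * m2 A)%E) ->
  forall A, measurable A ->
  (m1 \x m2)%E ((fun p => (f1 p.1, f2 p.2)) @^-1` A) = ((a1 * a2)%:E * (m1 \x m2) A)%E.
Proof.
move=> a1_ge0 a2_ge0 mf1 h1 h2 A mA; rewrite /product_measure1 /=.
have mx := measurable_fun_xsection m2 mA.
transitivity (\int[m1]_x (a2%:E * (((m2 \o xsection A) \o f1) x)))%E.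
  apply: eq_integral => x _ /=; rewrite -h2; last exact: measurable_xsection.
  by congr (m2 _); apply/seteqP; split => y; rewrite /xsection /= !inE.
rewrite ge0_integralZl_EFin//; last first.
  move=> _ Y mY; rewrite setTI; apply: (measurable_preimage mf1 (A := (m2 \o xsection A) @^-1` Y)).
  by rewrite -[X in measurable X]setTI; exact: mx.
have <- : (\int[pushforward m1 f1]_x (m2 \o xsection A) x =
    \int[m1]_x ((m2 \o xsection A) \o f1) x)%E.
  by rewrite (ge0_integral_pushforward mf1)// preimage_setT.
rewrite [in LHS](eq_measure_integral (mscale (NngNum a1_ge0) m1)); last first.
  by move=> B mB _; exact: h1.
by rewrite ge0_integral_mscale//= EFinM muleA (muleC a1%:E).
Qed.

Lemma vol_affine k (v : space3 R) (A : set (space3 R)) : k != 0 -> measurable A ->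
  vol ((fun p => k *: p + v) @^-1` A) = ((`|k| ^- 3)%:E * vol A)%E.
Proof.
move=> k0 mA.
have kp : 0 <= `|k|^-1 by rewrite invr_ge0.
have m1 b := measurable_affine1 k b.
have l1 b (B : set R) (mB : measurable B) := lebesgue_measure_affine1 b k0 mB.
have m2 : measurable_fun setT (fun q : R * R => (affine1 k v.1.1 q.1, affine1 k v.1.2 q.2)).
  by apply: measurable_fun_pair; apply: measurableT_comp.
have l2 (B : set (R * R)) (mB : measurable B) :=
  product_measure_preimage (m1 := lebesgue_measure) (m2 := lebesgue_measure)
    kp kp (m1 v.1.1) (l1 v.1.1) (l1 v.1.2) mB.
have k2p : 0 <= `|k|^-1 * `|k|^-1 by rewrite mulr_ge0.
have := product_measure_preimage (m1 := (lebesgue_measure \x lebesgue_measure)%E)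
  (m2 := lebesgue_measure) k2p kp m2 l2 (l1 v.2) mA.
have -> : `|k|^-1 * `|k|^-1 * `|k|^-1 = `|k| ^- 3 by rewrite -exprVn !exprS expr0 mulr1 mulrA.
by case: v {m2 l2} => -[].
Qed.

End AffineVolume.

(** Cauchy's functional equation for a monotone function. Enclosing n a between consecutive integers
    gives n |F a - a F 1| <= F 1 for every n, so the difference vanishes. *)
Lemma additive_nonneg_linear (R : realType) (F : R -> R) :
  (forall a, 0 <= a -> 0 <= F a) ->
  (forall a b, 0 <= a -> 0 <= b -> F (a + b) = F a + F b) ->
  forall a, 0 <= a -> F a = a * F 1.
Proof.
move=> F0 FD.
have F00 : F 0 = 0 by have := FD 0 0 (lexx _) (lexx _); rewrite addr0; lra.
have Fn n a : 0 <= a -> F (n%:R * a) = n%:R * F a.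
  move=> a0; elim: n => [|n IH]; first by rewrite !mul0r.
  by rewrite -natr1 !mulrDl !mul1r FD ?IH// mulr_ge0.
have Fle a b : 0 <= a -> a <= b -> F a <= F b.
  move=> a0 ab; have ba : 0 <= b - a by rewrite subr_ge0.
  by rewrite -[b](subrKC a) FD// lerDl F0.
move=> a a0; have F1 := F0 1 ler01.
apply/eqP; rewrite -subr_eq0 -normr_eq0; apply/negPn/negP => ne.
have Dp : 0 < `|F a - a * F 1| by rewrite lt_neqAle eq_sym ne /=.
have bound n : n%:R * `|F a - a * F 1| <= F 1.
  have na0 : 0 <= n%:R * a by rewrite mulr_ge0.
  have /andP[lo hi] := truncn_itv na0.
  have l : (Num.truncn (n%:R * a))%:R * F 1 <= n%:R * F a.
    by rewrite -(Fn n a a0) -Fn// mulr1; apply: Fle.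
  have h : n%:R * F a <= ((Num.truncn (n%:R * a)).+1)%:R * F 1.
    by rewrite -(Fn n a a0) -Fn// mulr1; apply: Fle => //; exact: ltW.
  have l' := ler_wpM2r F1 lo; have h' := ler_wpM2r F1 (ltW hi).
  rewrite -[X in X * _](@ger0_norm _ n%:R)// -normrM ler_norml.
  move: l h l' h'; rewrite -natr1; move: (Num.truncn _)%:R => N.
  by move: (F a) (F 1) => fa f1 *; lra.
have := archi_boundP (divr_ge0 F1 (ltW Dp)).
by rewrite ltr_pdivrMr// ltNge bound.
Qed.

Lemma scale3E (R : realType) k (p : space3 R) :
  (((k *: p).1.1 = (k * p.1.1)%R) * ((k *: p).1.2 = (k * p.1.2)%R) *
   ((k *: p).2 = (k * p.2)%R))%type.
Proof. by []. Qed.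

Lemma add3E (R : realType) (p q : space3 R) :
  ((((p + q)%R.1.1 = (p.1.1 + q.1.1)%R) * ((p + q)%R.1.2 = (p.1.2 + q.1.2)%R) *
   ((p + q)%R.2 = (p.2 + q.2)%R)))%type.
Proof. by []. Qed.

Lemma opp3E (R : realType) (p : space3 R) :
  (((- p)%R.1.1 = (- p.1.1)%R) * ((- p)%R.1.2 = (- p.1.2)%R) * ((- p)%R.2 = (- p.2)%R))%type.
Proof. by []. Qed.

(** * Covariant measures of boxes *)

Section CovariantMeasure.
Variable R : realType.
Variable m : {measure set (space3 R) -> \bar R}.

Definition affine_covariant := forall k (v : space3 R) (A : set (space3 R)),
  k != 0 -> measurable A ->
  m ((fun p => k *: p + v) @^-1` A) = ((`|k| ^- 3)%:E * m A)%E.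

Hypothesis m_affine : affine_covariant.
Hypothesis m_fin : (m (box (pt 0 0 0) (pt 1 1 1)) < +oo)%E.

Lemma measure_box_shift (lo hi v : space3 R) :
  m (box (lo + v) (hi + v)) = m (box lo hi).
Proof.
have := m_affine (- v) (oner_neq0 R) (measurable_box lo hi).
rewrite normr1 expr1n invr1 mul1e => <-; congr (m _).
apply/seteqP; split => p /boxP[h1 h2 h3]; apply/boxP; move: h1 h2 h3;
  by rewrite ?add3E ?scale3E ?opp3E ?scale1r ?add3E ?opp3E => h1 h2 h3; split; lra.
Qed.

(** A homothetic copy of the unit cube, with edge K larger than all sides of the box, contains the
    box. *)
Lemma measure_box_fin (lo hi : space3 R) : (m (box lo hi) < +oo)%E.
Proof.
pose K := 1 + `|hi.1.1 - lo.1.1| + `|hi.1.2 - lo.1.2| + `|hi.2 - lo.2|.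
have Kp : 0 < K by rewrite /K; apply: ltr_wpDr => //; apply: ltr_wpDr => //; rewrite ltr_wpDr.
have K0 : K^-1 != 0 by rewrite invr_eq0 gt_eqF.
have := m_affine (- (K^-1 *: lo)) K0 (measurable_box (pt 0 0 0) (pt 1 1 1)).
set A := _ @^-1` _ => mA.
have mAE : measurable A.
  rewrite (_ : A = box lo (lo + pt K K K)); first exact: measurable_box.
  apply/seteqP; split => p /boxP[h1 h2 h3]; apply/boxP; move: h1 h2 h3;
  rewrite /= -!mulrBr ?mul1r.
  + rewrite !pmulr_rgt0 ?invr_gt0// !subr_gt0 -!ler_pdivlMl ?invr_gt0// !invrK mulr1.
    by rewrite !lerBlDl.
  + rewrite !pmulr_rgt0 ?invr_gt0// !subr_gt0 -!ler_pdivlMl ?invr_gt0// !invrK mulr1.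
    by rewrite !lerBlDl.
apply: (@le_lt_trans _ _ (m A)); last first.
  by rewrite mA lte_mul_pinfty// ?lee_fin ?invr_ge0// ?exprn_ge0.
apply: le_measure; rewrite ?inE//; first exact: measurable_box.
move=> p /boxP[h1 h2 h3]; apply/boxP; rewrite /= -!mulrBr.
rewrite !pmulr_rgt0 ?invr_gt0// !subr_gt0 -!ler_pdivlMl ?invr_gt0// !invrK mulr1.
have n1 := ler_norm (hi.1.1 - lo.1.1); have n2 := ler_norm (hi.1.2 - lo.1.2).
have n3 := ler_norm (hi.2 - lo.2).
have k1 : 0 <= `|hi.1.1 - lo.1.1| by []. have k2 : 0 <= `|hi.1.2 - lo.1.2| by [].
have k3 : 0 <= `|hi.2 - lo.2| by [].
by move: h1 h2 h3 n1 n2 n3 k1 k2 k3; rewrite /K => *; split; lra.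
Qed.

Let F a b d := fine (m (box (pt 0 0 0) (pt a b d))).

Let mF a b d : m (box (pt 0 0 0) (pt a b d)) = (F a b d)%:E.
Proof. by rewrite /F fineK// ge0_fin_numE// measure_box_fin. Qed.

Let measure_box0 (lo hi : space3 R) :
  m (box lo hi) = m (box (pt 0 0 0) (pt (hi.1.1 - lo.1.1) (hi.1.2 - lo.1.2) (hi.2 - lo.2))).
Proof.
rewrite -(measure_box_shift (pt 0 0 0) _ lo); congr (m (box _ _)).
  by case: lo => -[x y] z; congr (_, _, _); rewrite /= add0r.
by case: hi lo => -[x y] z [[x' y'] z']; congr (_, _, _); rewrite /= subrK.
Qed.

Let box_split (A B C : set (space3 R)) : measurable A -> measurable B ->
  A `&` B = set0 -> C = A `|` B -> m C = (m A + m B)%E.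
Proof. by move=> mA mB AB ->; rewrite measureU. Qed.

(** After a translation to the origin the measure is a function of the three side lengths. Cutting a
    box by a plane shows that it is additive, hence linear, in each of them. *)
Lemma measure_box (lo hi : space3 R) : box_le lo hi ->
  m (box lo hi) = (fine (m (box (pt 0 0 0) (pt 1 1 1))) * box_vol lo hi)%:E.
Proof.
case=> l1 l2 l3; rewrite measure_box0 mF; congr _%:E.
have F0 a b d : 0 <= F a b d by rewrite fine_ge0.
have D1 a a' b d : 0 <= a -> 0 <= a' -> F (a + a') b d = F a b d + F a' b d.
  move=> a0 a'0; apply: EFin_inj; rewrite EFinD -!mF.
  rewrite (box_split (measurable_box (pt 0 0 0) (pt a b d))
    (measurable_box (pt a 0 0) (pt (a + a') b d))).
  + by congr (_ + _)%E; rewrite measure_box0 /= !subr0 addrAC subrr add0r.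
  + by rewrite -subset0 => p [/boxP[/= h _ _] /boxP[/= h' _ _]]; move: h h'; lra.
  + apply/seteqP; split => p.
      move=> /boxP[/= h1 h2 h3].
      by have [h|h] := leP p.1.1 a; [left|right]; apply/boxP; split => //=; move: h h1; lra.
    by case=> /boxP[/= h1 h2 h3]; apply/boxP; split => //=; move: h1 a0 a'0; lra.
have D2 a b b' d : 0 <= b -> 0 <= b' -> F a (b + b') d = F a b d + F a b' d.
  move=> a0 a'0; apply: EFin_inj; rewrite EFinD -!mF.
  rewrite (box_split (measurable_box (pt 0 0 0) (pt a b d))
    (measurable_box (pt 0 b 0) (pt a (b + b') d))).
  + by congr (_ + _)%E; rewrite measure_box0 /= !subr0 (addrAC b) subrr add0r.
  + by rewrite -subset0 => p [/boxP[/= _ h _] /boxP[/= _ h' _]]; move: h h'; lra.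
  + apply/seteqP; split => p.
      move=> /boxP[/= h1 h2 h3].
      by have [h|h] := leP p.1.2 b; [left|right]; apply/boxP; split => //=; move: h h2; lra.
    by case=> /boxP[/= h1 h2 h3]; apply/boxP; split => //=; move: h2 a0 a'0; lra.
have D3 a b d d' : 0 <= d -> 0 <= d' -> F a b (d + d') = F a b d + F a b d'.
  move=> a0 a'0; apply: EFin_inj; rewrite EFinD -!mF.
  rewrite (box_split (measurable_box (pt 0 0 0) (pt a b d))
    (measurable_box (pt 0 0 d) (pt a b (d + d')))).
  + by congr (_ + _)%E; rewrite measure_box0 /= !subr0 (addrAC d) subrr add0r.
  + by rewrite -subset0 => p [/boxP[/= _ _ h] /boxP[/= _ _ h']]; move: h h'; lra.
  + apply/seteqP; split => p.
      move=> /boxP[/= h1 h2 h3].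
      by have [h|h] := leP p.2 d; [left|right]; apply/boxP; split => //=; move: h h3; lra.
    by case=> /boxP[/= h1 h2 h3]; apply/boxP; split => //=; move: h3 a0 a'0; lra.
have lin1 a b d : 0 <= a -> F a b d = a * F 1 b d.
  by apply: (additive_nonneg_linear (F := fun a => F a b d)) => // ? ?; exact: D1.
have lin2 a b d : 0 <= b -> F a b d = b * F a 1 d.
  by apply: (additive_nonneg_linear (F := fun b => F a b d)) => // ? ?; exact: D2.
have lin3 a b d : 0 <= d -> F a b d = d * F a b 1.
  by apply: (additive_nonneg_linear (F := F a b)) => // ? ?; exact: D3.
rewrite lin1 ?subr_ge0// lin2 ?subr_ge0// lin3 ?subr_ge0//.
by rewrite mulrC /box_vol /F; ring.
Qed.

End CovariantMeasure.

(** * Dissections of the cube *)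

Section Dissection.
Variable R : realType.
Implicit Types (p q s : space3 R) (i j : bool * bool) (t : bool).

Lemma scale1E (k x : R) : k *: x = k * x.
Proof. by []. Qed.

Definition dot s p : R := s.1.1 * p.1.1 + s.1.2 * p.1.2 + s.2 * p.2.

(* The vertices of a regular tetrahedron inscribed in the cube [-1, 1]^3, the four
   points with product of coordinates 1; the other vertices of the cube are their
   opposites. *)
Definition tvert i : space3 R := pt (sg R i.1 * sg R i.2) (sg R i.1) (sg R i.2).

(** The facet opposite to [tvert i] has the outward normal [- tvert i]. *)
Definition tetra : set (space3 R) := [set p | forall i, - dot (tvert i) p <= 1].

Definition corner s : set (space3 R) :=
  [set p | [/\ 0 <= s.1.1 * p.1.1, 0 <= s.1.2 * p.1.2, 0 <= s.2 * p.2 & dot s p <= 1]].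

Definition open_corner s : set (space3 R) :=
  [set p | [/\ 0 < s.1.1 * p.1.1, 0 < s.1.2 * p.1.2, 0 < s.2 * p.2 & dot s p < 1]].

(** The octahedron |x| + |y| + |z| <= 1, whose vertices are the midpoints of the edges of
    [tetra]. *)
Definition octa : set (space3 R) := [set p | forall i, `|dot (tvert i) p| <= 1].

Lemma measurable_coord1 : measurable_fun setT (fun p : space3 R => p.1.1).
Proof. by apply: measurableT_comp measurable_fst measurable_fst. Qed.
Lemma measurable_coord2 : measurable_fun setT (fun p : space3 R => p.1.2).
Proof. by apply: measurableT_comp measurable_snd measurable_fst. Qed.
Lemma measurable_coord3 : measurable_fun setT (fun p : space3 R => p.2).
Proof. exact: measurable_snd. Qed.

Lemma measurable_linear3 (a b c : R) :
  measurable_fun setT (fun p : space3 R => a * p.1.1 + b * p.1.2 + c * p.2).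
Proof.
have mZ k (f : space3 R -> R) : measurable_fun setT f ->
    measurable_fun setT (fun p => k * f p).
  by move=> mf; exact: measurable_realfun.measurable_funM.
apply: measurable_realfun.measurable_funD; last exact: mZ measurable_coord3.
by apply: measurable_realfun.measurable_funD; apply: mZ;
  [exact: measurable_coord1|exact: measurable_coord2].
Qed.

Lemma measurable_le_set (f : space3 R -> R) (r : R) :
  measurable_fun setT f -> measurable [set p | f p <= r].
Proof.
move=> mf; rewrite (_ : [set _ | _] = f @^-1` `]-oo, r]).
  by apply: measurable_preimage.
by apply/seteqP; split => p /=; rewrite in_itv.
Qed.

Lemma measurable_lt_set (f : space3 R -> R) (r : R) :
  measurable_fun setT f -> measurable [set p | f p < r].
Proof.
move=> mf; rewrite (_ : [set _ | _] = f @^-1` `]-oo, r[).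
  by apply: measurable_preimage.
by apply/seteqP; split => p /=; rewrite in_itv.
Qed.

Lemma measurable_tetra : measurable tetra.
Proof.
rewrite (_ : tetra = \bigcap_(i in [set: bool * bool]) [set p | dot (- tvert i) p <= 1]).
  apply: fin_bigcap_measurable => // i _; apply: measurable_le_set.
  exact: measurable_linear3.
have dotN i p : - dot (tvert i) p = dot (- tvert i) p.
  by rewrite /dot !opp3E !mulNr !opprD.
by apply/seteqP; split => p h i *; [rewrite /= -dotN; exact: h|rewrite dotN; exact: h].
Qed.

Lemma measurable_corner s : measurable (corner s).
Proof.
rewrite (_ : corner s = [set p | dot (pt (- s.1.1) 0 0) p <= 0] `&`
  ([set p | dot (pt 0 (- s.1.2) 0) p <= 0] `&` ([set p | dot (pt 0 0 (- s.2)) p <= 0] `&`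
   [set p | dot s p <= 1]))).
  by do 3 (apply: measurableI; first by apply: measurable_le_set; exact: measurable_linear3);
    apply: measurable_le_set; exact: measurable_linear3.
apply/seteqP; split => p; rewrite /corner /dot /=.
  by move=> [h1 h2 h3 h4]; split; [|split; [|split]] => //; move: h1 h2 h3; lra.
by move=> [h1 [h2 [h3 h4]]]; split => //; move: h1 h2 h3; lra.
Qed.

Lemma measurable_open_corner s : measurable (open_corner s).
Proof.
rewrite (_ : open_corner s = [set p | dot (pt (- s.1.1) 0 0) p < 0] `&`
  ([set p | dot (pt 0 (- s.1.2) 0) p < 0] `&` ([set p | dot (pt 0 0 (- s.2)) p < 0] `&`
   [set p | dot s p < 1]))).
  by do 3 (apply: measurableI; first by apply: measurable_lt_set; exact: measurable_linear3);
    apply: measurable_lt_set; exact: measurable_linear3.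
apply/seteqP; split => p; rewrite /open_corner /dot /=.
  by move=> [h1 h2 h3 h4]; split; [|split; [|split]] => //; move: h1 h2 h3; lra.
by move=> [h1 [h2 [h3 h4]]]; split => //; move: h1 h2 h3; lra.
Qed.

Lemma cuboctahedronP p : cuboctahedron R p <->
  [/\ `|p.1.1| <= 1, `|p.1.2| <= 1, `|p.2| <= 1 & `|p.1.1| + `|p.1.2| + `|p.2| <= 2].
Proof.
rewrite /cuboctahedron /= !ge_max.
by split => [[/andP[/andP[-> ->] ->] ->]|[-> -> -> ->]].
Qed.

Lemma measurable_cuboctahedron : measurable (cuboctahedron R).
Proof.
have n1 := measurableT_comp (@measurable_realfun.normr_measurable R setT) measurable_coord1.
have n2 := measurableT_comp (@measurable_realfun.normr_measurable R setT) measurable_coord2.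
have n3 := measurableT_comp (@measurable_realfun.normr_measurable R setT) measurable_coord3.
rewrite (_ : cuboctahedron R = [set p | `|p.1.1| <= 1] `&` ([set p | `|p.1.2| <= 1] `&`
  ([set p | `|p.2| <= 1] `&` [set p | `|p.1.1| + `|p.1.2| + `|p.2| <= 2]))).
  do 3 (apply: measurableI; first by apply: measurable_le_set).
  by apply: measurable_le_set; apply: measurable_realfun.measurable_funD => //;
    apply: measurable_realfun.measurable_funD.
apply/seteqP; split => p.
  by move/cuboctahedronP => [? ? ? ?]; split; [|split; [|split]].
by move=> [? [? [? ?]]]; apply/cuboctahedronP.
Qed.

Definition cube1 : set (space3 R) := box (pt (-1) (-1) (-1)) (pt 1 1 1).

(** A point violating the inequality of index i lies in the piece cut off at the cube vertex
    [- tvert i], a copy of [corner (tvert i)] enlarged by the factor 2. *)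
Lemma cube_cover : cube1 `<=` tetra `|`
  \bigcup_(i in [set: bool * bool]) ((fun p => 2^-1 *: p + 2^-1 *: tvert i) @^-1` corner (tvert i)).
Proof.
move=> p /boxP[/= h1 h2 h3].
have [h|/existsNP[i]] := pselect (tetra p); [by left|].
move/negP; rewrite -ltNge => h; right; exists i => //.
move: h; rewrite /corner /dot /= !scale1E.
by case: i => -[] -[]; rewrite /tvert /sg /= => h; split; lra.
Qed.

Lemma cube_tetra_disjoint i p :
  open_corner (tvert i) (2^-1 *: p + 2^-1 *: tvert i) -> ~ tetra p.
Proof.
move=> h /(_ i); move: h; rewrite /open_corner /dot /= !scale1E.
by case: i => -[] -[]; rewrite /tvert /sg /= => -[]; lra.
Qed.

(** A tetrahedron consists of four half-size copies at its vertices and a central octahedron. A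
    point outside the octahedron has scalar product above 1 with some vertex and lies in the copy
    there. *)
Lemma tetra_cover : tetra `<=`
  (\bigcup_(i in [set: bool * bool]) ((fun p => 2 *: p + - tvert i) @^-1` tetra)) `|` octa.
Proof.
move=> p Tp; have [h|/existsNP[i]] := pselect (octa p); [by right|].
move/negP; rewrite -ltNge ltr_normr => /orP[h|]; last first.
  by move=> h; have := Tp i; rewrite leNgt h.
left; exists i => // j.
have := Tp (true, true); have := Tp (true, false).
have := Tp (false, true); have := Tp (false, false).
move: h; rewrite /dot /= !scale1E /tvert /sg.
by case: i => -[] -[]; case: j => -[] -[] /=; lra.
Qed.

Definition pm_tvert (ti : bool * (bool * bool)) : space3 R := sg R ti.1 *: tvert ti.2.

Lemma octa_cover : octa `<=` \bigcup_(ti in [set: bool * (bool * bool)]) corner (pm_tvert ti).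
Proof.
move=> p Op.
have := Op (true, true); have := Op (true, false).
have := Op (false, true); have := Op (false, false).
rewrite /dot /tvert /sg /= !ler_norml => o1 o2 o3 o4.
have ex (x : R) : exists b, 0 <= sg R b * x.
  by have [h|h] := leP 0 x; [exists true|exists false]; rewrite /sg; lra.
have [a ha] := ex p.1.1; have [b hb] := ex p.1.2; have [d hd] := ex p.2.
(* t encodes the product of the signs a, b, d; multiplying the sign vector by it makes the product
   1, which gives a vertex of the tetrahedron. *)
pose t := a == (b == d).
exists (t, (t == b, t == d)) => //; rewrite /t.
rewrite /corner /dot /pm_tvert /tvert /= !scale1E.
move: ha hb hd o1 o2 o3 o4; case: a {t}; case: b; case: d; rewrite /sg /=;
  move: p.1.1 p.1.2 p.2 => x y z; clear=> *; split; lra.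
Qed.

(** In the corner at the cube vertex w the scalar product of w and p exceeds 2, against |x| + |y| +
    |z| <= 2. *)
Lemma cuboctahedron_corner_disjoint ti p :
  open_corner (- pm_tvert ti) (1 *: p + - pm_tvert ti) -> ~ cuboctahedron R p.
Proof.
move=> h /cuboctahedronP[_ _ _]; rewrite /open_corner /dot /pm_tvert in h *.
move: h; rewrite /= !scale1E.
have n1 := ler_norm p.1.1; have n2 := ler_norm p.1.2; have n3 := ler_norm p.2.
have m1 := ler_norm (- p.1.1); have m2 := ler_norm (- p.1.2); have m3 := ler_norm (- p.2).
rewrite !normrN in m1 m2 m3.
by case: ti => -[] [[] []]; rewrite /tvert /sg /= => -[_ _ _ h] h'; lra.
Qed.

(** The sum of two vertices of the tetrahedron is twice a signed unit vector, so a common point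
    would have a coordinate beyond the cube. *)
Lemma trivIset_tetra_corners : trivIset [set: bool * bool]
  (fun i => [set p | cube1 p] `&` (fun p => 2^-1 *: p + 2^-1 *: tvert i) @^-1` open_corner (tvert i)).
Proof.
move=> i j _ _ [p [[/boxP[/= h1 h2 h3] hi] [_ hj]]]; move: hi hj.
rewrite /open_corner /dot /= !scale1E.
case: i => -[] -[]; case: j => -[] -[]; rewrite /tvert /sg //= => -[_ _ _ h] [_ _ _ h']; exfalso; lra.
Qed.

(** In the corner at w every product of coordinates of w and p is below 1, while their sum exceeds
    2. So all three are positive, and the signs of p determine w. *)
Lemma trivIset_cuboctahedron_corners : trivIset [set: bool * (bool * bool)]
  (fun ti => (fun p => 1 *: p + - pm_tvert ti) @^-1` open_corner (- pm_tvert ti)).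
Proof.
move=> i j _ _ [p [hi hj]]; move: hi hj.
rewrite /open_corner /dot /= !scale1E.
case: i => -[] [] [] []; case: j => -[] [] [] []; rewrite /tvert /sg //= => -[a1 a2 a3 h] [b1 b2 b3 h']; exfalso; lra.
Qed.
End Dissection.

Section FiniteUnions.
Context d (T : measurableType d) (R : realType) (m : {measure set T -> \bar R}).
Variable I : finType.

Lemma fsum_setT (F : I -> \bar R) : (\sum_(i \in [set: I]) F i = \sum_i F i)%E.
Proof.
rewrite [RHS]fsbig_seq ?index_enum_uniq//; apply: eq_fsbigl.
by apply/seteqP; split => i _ //=; rewrite mem_index_enum.
Qed.

Lemma measure_fin_cover (A : set T) (F : I -> set T) :
  measurable A -> (forall i, measurable (F i)) ->
  A `<=` \bigcup_(i in [set: I]) F i -> (m A <= \sum_i m (F i))%E.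
Proof. by move=> mA mF AF; rewrite -fsum_setT; apply: content_sub_fsum => //; exact: finite_finset. Qed.

Lemma measure_fin_pack (A B : set T) (F : I -> set T) :
  measurable A -> measurable B -> (forall i, measurable (F i)) ->
  trivIset [set: I] F -> (forall i, A `&` F i = set0) ->
  A `<=` B -> (forall i, F i `<=` B) -> (m A + \sum_i m (F i) <= m B)%E.
Proof.
move=> mA mB mF tF AF AB FB; rewrite -fsum_setT -measure_fin_bigcup//; last exact: finite_finset.
have mU : measurable (\bigcup_(i in [set: I]) F i).
  by apply: fin_bigcup_measurable => //; exact: finite_finset.
rewrite -measureU//; last first.
  by rewrite setI_bigcupr; apply: bigcup0 => i _.
apply: le_measure; rewrite ?inE//; first exact: measurableU.
by move=> p [/AB//|[i _ /FB]].
Qed.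
End FiniteUnions.

Section DissectionMeasure.
Variable R : realType.
Implicit Types (p s : space3 R).
Variable m : {measure set (space3 R) -> \bar R}.
Hypothesis m_affine : affine_covariant m.
Hypothesis m_fin : (m (box (pt 0 0 0) (pt 1 1 1)) < +oo)%E.
Let c := fine (m (box (pt 0 0 0) (pt 1 1 1))).
Let mu A := fine (m A).

Lemma small_step (M e : R) : 0 <= M -> 0 < e -> exists d, [/\ 0 < d, d < 1 & M * d <= e].
Proof.
move=> M0 e0; have p : 0 < M + e + 1 by lra.
exists (e / (M + e + 1)); split; first by rewrite divr_gt0.
  by rewrite ltr_pdivrMr//; lra.
by rewrite mulrA ler_pdivrMr//; have := mulr_gt0 e0 e0; lra.
Qed.

(** Boxes are half-open, so closed bodies that touch the faces of the cube [-1, 1]^3 are enclosed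
    with r > 1; [squeeze] then lets r tend to 1. *)
Definition big_box r : set (space3 R) := box (pt (- r) (- r) (- r)) (pt r r r).

Lemma mu_fin r (A : set (space3 R)) : measurable A -> A `<=` big_box r -> m A = (mu A)%:E.
Proof.
move=> mA AB; rewrite /mu fineK// ge0_fin_numE//.
apply: le_lt_trans (measure_box_fin m_affine m_fin (pt (- r) (- r) (- r)) (pt r r r)).
by apply: le_measure; rewrite ?inE//; exact: measurable_box.
Qed.

Lemma mu_affine r k v (A : set (space3 R)) : k != 0 -> measurable A -> A `<=` big_box r ->
  m ((fun p => k *: p + v) @^-1` A) = (`|k| ^- 3 * mu A)%:E.
Proof. by move=> k0 mA AB; rewrite m_affine// (mu_fin mA AB). Qed.

Lemma measurable_affine_fun k v :
  measurable_fun [set: space3 R] (fun p : space3 R => k *: p + v).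
Proof.
rewrite (_ : (fun _ => _) = (fun p : space3 R =>
  ((affine1 k v.1.1 p.1.1, affine1 k v.1.2 p.1.2), affine1 k v.2 p.2))).
  apply/measurable_fun_pairP; split.
    apply/measurable_fun_pairP; split.
      exact: (measurableT_comp (measurable_affine1 k v.1.1) (@measurable_coord1 R)).
    exact: (measurableT_comp (measurable_affine1 k v.1.2) (@measurable_coord2 R)).
  exact: (measurableT_comp (measurable_affine1 k v.2) (@measurable_coord3 R)).
by apply/funext => -[[x y] z]; case: v => -[].
Qed.

Lemma measurable_affine k v (A : set (space3 R)) : measurable A ->
  measurable ((fun p => k *: p + v) @^-1` A).
Proof. exact: (measurable_preimage (measurable_affine_fun k v)). Qed.

Lemma abs_le_big (p : space3 R) (r : R) : `|p.1.1| < r -> `|p.1.2| < r -> `|p.2| < r -> big_box r p.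
Proof.
rewrite !ltr_norml => /andP[? ?] /andP[? ?] /andP[? ?].
by apply/boxP; split; rewrite /=; lra.
Qed.

Lemma unit_sign (s x : R) : `|s| = 1 -> `|x| = `|s * x|.
Proof. by move=> s1; rewrite normrM s1 mul1r. Qed.

Definition sign3 (s : space3 R) := [/\ `|s.1.1| = 1, `|s.1.2| = 1 & `|s.2| = 1].

Lemma sign3N s : sign3 s -> sign3 (- s).
Proof. by case=> ? ? ?; split; rewrite opp3E normrN. Qed.

Lemma sign3_tvert i : sign3 (tvert R i).
Proof.
by case: i => -[] -[]; split;
  rewrite /tvert /sg /= ?mul1r ?mulN1r ?opprK ?normrN ?normr1.
Qed.

Lemma sign3_pm_tvert i : sign3 (pm_tvert R i).
Proof.
rewrite /pm_tvert; case: (i.1); rewrite /sg ?scale1r ?scaleN1r; last apply: sign3N;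
  exact: sign3_tvert.
Qed.

Lemma corner_big s : sign3 s -> corner s `<=` big_box 2.
Proof.
case=> s1 s2 s3 p [h1 h2 h3]; rewrite /dot => h4.
by apply: abs_le_big; [rewrite (unit_sign _ s1)|rewrite (unit_sign _ s2)|rewrite (unit_sign _ s3)];
  rewrite ger0_norm//; lra.
Qed.

Lemma open_corner_sub s : open_corner s `<=` corner s.
Proof. by move=> p [h1 h2 h3 h4]; split; exact: ltW. Qed.

Lemma tetra_abs p : tetra p -> [/\ `|p.1.1| <= 1, `|p.1.2| <= 1 & `|p.2| <= 1].
Proof.
move=> T; have := T (true, true); have := T (true, false).
have := T (false, true); have := T (false, false).
rewrite /dot /tvert /sg /= => *; split; rewrite ler_norml; lra.
Qed.

Lemma cuboctahedron_abs p : cuboctahedron R p -> [/\ `|p.1.1| <= 1, `|p.1.2| <= 1 & `|p.2| <= 1].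
Proof. by move/cuboctahedronP => []. Qed.

Lemma abs_big r p : 1 < r -> [/\ `|p.1.1| <= 1, `|p.1.2| <= 1 & `|p.2| <= 1] -> big_box r p.
Proof. by move=> r1 [h1 h2 h3]; apply: abs_le_big; apply: le_lt_trans r1. Qed.

Lemma tetra_big r : 1 < r -> @tetra R `<=` big_box r.
Proof. by move=> r1 p /tetra_abs; exact: abs_big. Qed.

Let m_big r : 0 <= r -> m (big_box r) = (c * (2 * r) ^+ 3)%:E.
Proof.
move=> r0; rewrite measure_box//; last by split; rewrite /=; lra.
by rewrite /box_vol /= -/c; congr (_%:E); ring.
Qed.

(* The corner shrunk by 1 - e and moved by (e / 4) s lies in the open corner. *)
Lemma corner_open_corner s : sign3 s -> mu (corner s) <= mu (open_corner s).
Proof.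
move=> ss; have mc := measurable_corner s; have mo := measurable_open_corner s.
have cb := corner_big ss.
have ob : open_corner s `<=` big_box 2 by move=> p /open_corner_sub /cb.
have x0 : 0 <= mu (corner s) by rewrite fine_ge0.
have bound e : 0 < e -> e < 1 -> mu (corner s) * (1 - e) ^+ 3 <= mu (open_corner s).
  move=> e0 e1; have e1' : 0 < 1 - e by lra.
  have k0 : (1 - e)^-1 != 0 by rewrite invr_eq0 gt_eqF.
  rewrite -lee_fin -(mu_fin mo ob).
  have := mu_affine (- ((1 - e)^-1 * (e / 4)) *: s) k0 mc cb.
  rewrite normfV exprVn invrK (gtr0_norm e1') [X in X%:E]mulrC => <-.
  apply: le_measure; rewrite ?inE//; first exact: measurable_affine.
  move=> p [h1 h2 h3 h4]; case: ss => s1 s2 s3.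
  have sq (a : R) : `|a| = 1 -> a * a = 1.
    by move=> a1; rewrite -expr2 -real_normK ?num_real// a1 expr1n.
  have q1 := sq _ s1; have q2 := sq _ s2; have q3 := sq _ s3.
  have E (a x : R) : a * a = 1 ->
      a * ((1 - e)^-1 * x + - ((1 - e)^-1 * (e / 4)) * a) = (1 - e)^-1 * (a * x - e / 4).
    by move=> aa; transitivity ((1 - e)^-1 * (a * x - e / 4 * (a * a))); [ring|rewrite aa mulr1].
  move: h1 h2 h3 h4; rewrite /dot !add3E !scale3E !E// -!mulrDr.
  rewrite !pmulr_rge0 ?invr_gt0// ler_pdivrMl// mulr1 => h1 h2 h3 h4.
  by split; rewrite /dot; lra.
apply/ler_addgt0Pr => e e0.
have M0 : 0 <= 3 * mu (corner s) by rewrite mulr_ge0.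
have [d [d0 d1 de]] := small_step M0 e0.
have := bound d d0 d1.
(* (1 - d)^3 = 1 - 3 d + d^2 (3 - d), so only the loss 3 d matters. *)
have : 0 <= mu (corner s) * (d ^+ 2 * (3 - d)).
  by apply: mulr_ge0 => //; apply: mulr_ge0; [exact: sqr_ge0|lra].
by move: x0 de; move: (mu (corner s)) (mu (open_corner s)) => x y *; lra.
Qed.

Let mu_corner_opp s : sign3 s -> mu (corner (- s)) = mu (corner s).
Proof.
move=> ss; have k0 : (-1 : R) != 0 by rewrite oppr_eq0 oner_neq0.
have := mu_affine 0 k0 (measurable_corner s) (corner_big ss).
rewrite normrN normr1 expr1n invr1 mul1r => E.
rewrite /mu -[RHS]/(fine (mu (corner s))%:E) -E; congr (fine (m _)).
by apply/seteqP; split => p; rewrite /corner /dot /= ?opp3E !scaleN1r !addr0 ?opp3E !mulNr !mulrN.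
Qed.

(* With K the measure of the corners at the origin of four octants, one of each
   opposite pair, the next four lemmas force K = 2c/3, and then bound the measures
   of the tetrahedron and of the cuboctahedron. *)
Let K := \sum_i mu (corner (tvert R i)).

Let sum_pm (f : space3 R -> R) : (forall i, f (- tvert R i) = f (tvert R i)) ->
  \sum_ti f (pm_tvert R ti) = 2 * \sum_i f (tvert R i).
Proof.
move=> fN; rewrite -(pair_bigA _ (fun t i => f (pm_tvert R (t, i)))) /= big_bool /=.
under eq_bigr do rewrite /pm_tvert /sg scale1r.
under [X in _ + X]eq_bigr do rewrite /pm_tvert /sg scaleN1r fN.
by rewrite mulr2n mulrDl mul1r.
Qed.

Let c_ge0 : 0 <= c. Proof. by rewrite fine_ge0. Qed.

Lemma dissect_cube : 8 * c <= mu (@tetra R) + 8 * K.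
Proof.
have mt := @measurable_tetra R.
have tf := mu_fin mt (tetra_big (ltr1n R 2)).
have k0 : (2^-1 : R) != 0 by rewrite invr_eq0.
have cf i := mu_affine (2^-1 *: tvert R i) k0 (measurable_corner (tvert R i))
  (corner_big (sign3_tvert i)).
have mcor i := measurable_affine 2^-1 (2^-1 *: tvert R i) (measurable_corner (tvert R i)).
have mU : measurable (\bigcup_(i in [set: bool * bool])
    ((fun p => 2^-1 *: p + 2^-1 *: tvert R i) @^-1` corner (tvert R i))).
  by apply: fin_bigcup_measurable => //; exact: finite_finset.
have := @cube_cover R; move/(le_measure m).
rewrite !inE => /(_ (measurable_box _ _) (measurableU _ _ mt mU)) h.
have {}h := le_trans h (measureU2 m mt mU).
have := measure_fin_cover m mU mcor (@subset_refl _ _) => h'.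
have {}h := le_trans h (leeD2l (m (@tetra R)) h').
move: h; rewrite (eq_bigr _ (fun i _ => cf i)) sumEFin tf -EFinD.
rewrite [X in (X <= _)%E](m_big ler01) lee_fin -mulr_sumr -/K.
rewrite normfV exprVn invrK (ger0_norm (ler0n R 2)).
by lra.
Qed.

Lemma dissect_tetra : mu (@tetra R) <= mu (@tetra R) / 2 + 2 * K.
Proof.
have mt := @measurable_tetra R.
have tb := tetra_big (ltr1n R 2); have tf := mu_fin mt tb.
have k0 : (2 : R) != 0 by [].
have hf i := mu_affine (- tvert R i) k0 mt tb.
have mh i := measurable_affine 2 (- tvert R i) mt.
have mU : measurable (\bigcup_(i in [set: bool * bool])
    ((fun p => 2 *: p + - tvert R i) @^-1` @tetra R)).
  by apply: fin_bigcup_measurable => //; exact: finite_finset.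
have mpm ti := measurable_corner (pm_tvert R ti).
have mV : measurable (\bigcup_(ti in [set: bool * (bool * bool)]) corner (pm_tvert R ti)).
  by apply: fin_bigcup_measurable => //; exact: finite_finset.
have sub := subset_trans (@tetra_cover R) (setUS (@octa_cover R)).
have := le_measure m _ _ sub.
rewrite !inE => /(_ mt (measurableU _ _ mU mV)) h.
have {}h := le_trans h (measureU2 m mU mV).
have h1 := measure_fin_cover m mU mh (@subset_refl _ _).
have h2 := measure_fin_cover m mV mpm (@subset_refl _ _).
have {}h := le_trans h (leeD h1 h2).
have cf ti := mu_fin (mpm ti) (corner_big (sign3_pm_tvert ti)).
move: h; rewrite (eq_bigr _ (fun i _ => hf i)) (eq_bigr _ (fun i _ => cf i)).
rewrite !sumEFin [X in (X <= _)%E]tf -EFinD lee_fin (sum_pm (f := fun s => mu (corner s))); last first.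
  by move=> i; rewrite mu_corner_opp//; exact: sign3_tvert.
rewrite sumr_const card_prod card_bool -/K (ger0_norm (ler0n R 2)).
by move: (mu (@tetra R)) K => t k; rewrite -mulr_natr; lra.
Qed.

Let squeeze (x : R) : (forall e, 0 < e -> e < 1 -> x <= c * (2 * (1 + e)) ^+ 3) -> x <= 8 * c.
Proof.
move=> h; apply/ler_addgt0Pr => e e0.
(* (1 + d)^3 <= 1 + 7 d for d <= 1, and 56 = 8 times 7. *)
have M0 : 0 <= 56 * c by rewrite mulr_ge0.
have [d [d0 d1 de]] := small_step M0 e0.
have := h d d0 d1.
have dd : 0 <= d * (1 - d) by apply: mulr_ge0; lra.
have : 0 <= c * (d * (1 - d)) by exact: mulr_ge0.
have : 0 <= c * (d * (1 - d) * (1 + d)).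
  by apply: mulr_ge0 => //; apply: mulr_ge0 => //; lra.
by move: c_ge0 de; move: c => c' *; lra.
Qed.

Lemma pack_tetra : mu (@tetra R) + 8 * K <= 8 * c.
Proof.
apply: squeeze => e e0 e1.
have mt := @measurable_tetra R.
have tb : @tetra R `<=` big_box (1 + e) by apply: tetra_big; lra.
have tf := mu_fin mt tb.
have k0 : (2^-1 : R) != 0 by rewrite invr_eq0.
have ob i : open_corner (tvert R i) `<=` big_box 2.
  by move=> p /open_corner_sub; apply: corner_big; exact: sign3_tvert.
have cf i := mu_affine (2^-1 *: tvert R i) k0 (measurable_open_corner (tvert R i)) (ob i).
have mcor i := measurable_affine 2^-1 (2^-1 *: tvert R i) (measurable_open_corner (tvert R i)).
have in_cube i : (fun p => 2^-1 *: p + 2^-1 *: tvert R i) @^-1` open_corner (tvert R i)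
    `<=` @cube1 R.
  move=> p; rewrite /open_corner /dot /= !scale1E => h; apply/boxP; move: h.
  by case: i => -[] -[]; rewrite /tvert /sg /= => -[h1 h2 h3 h4]; split; lra.
have mB : measurable (big_box (1 + e)) by exact: measurable_box.
have tr : trivIset [set: bool * bool]
    (fun i => (fun p => 2^-1 *: p + 2^-1 *: tvert R i) @^-1` open_corner (tvert R i)).
  apply/trivIsetP => i j _ _ ij.
  have /trivIsetP/(_ i j I I ij) := @trivIset_tetra_corners R.
  rewrite -!subset0 => h p [pi pj]; apply: (h p).
  by split; split => //; [exact: in_cube pi|exact: in_cube pj].
have dj i : tetra (R:=R) `&` ((fun p => 2^-1 *: p + 2^-1 *: tvert R i) @^-1`
    open_corner (tvert R i)) = set0.
  by rewrite -subset0 => p [tp /cube_tetra_disjoint].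
have cb i : (fun p => 2^-1 *: p + 2^-1 *: tvert R i) @^-1` open_corner (tvert R i)
    `<=` big_box (1 + e).
  by move=> p /in_cube /boxP[/= h1 h2 h3]; apply/boxP; split; rewrite /=; lra.
have := measure_fin_pack m mt mB mcor tr dj tb cb.
rewrite (eq_bigr _ (fun i _ => cf i)) sumEFin tf m_big; last lra.
rewrite -EFinD lee_fin -mulr_sumr => h; apply: le_trans h.
rewrite normfV exprVn invrK (ger0_norm (ler0n R 2)) lerD2l.
rewrite (_ : 2 ^+ 3 = 8 :> R); last by ring.
rewrite ler_wpM2l//; apply: ler_sum => i _.
by apply: corner_open_corner; exact: sign3_tvert.
Qed.

Lemma pack_cuboctahedron : mu (cuboctahedron R) + 2 * K <= 8 * c.
Proof.
apply: squeeze => e e0 e1.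
have mt := @measurable_cuboctahedron R.
have tb : cuboctahedron R `<=` big_box (1 + e).
  by move=> p /cuboctahedron_abs; apply: abs_big; lra.
have tf := mu_fin mt tb.
have ss ti := sign3N (sign3_pm_tvert ti).
have ob ti : open_corner (- pm_tvert R ti) `<=` big_box 2.
  by move=> p /open_corner_sub; apply: corner_big; exact: ss.
have cf ti := mu_affine (- pm_tvert R ti) (oner_neq0 R)
  (measurable_open_corner (- pm_tvert R ti)) (ob ti).
have mcor ti := measurable_affine 1 (- pm_tvert R ti) (measurable_open_corner (- pm_tvert R ti)).
have mB : measurable (big_box (1 + e)) by exact: measurable_box.
have dj i : cuboctahedron R `&` ((fun p => 1 *: p + - pm_tvert R i) @^-1`
    open_corner (- pm_tvert R i)) = set0.
  by rewrite -subset0 => p [tp /cuboctahedron_corner_disjoint].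
have cb ti : (fun p => 1 *: p + - pm_tvert R ti) @^-1` open_corner (- pm_tvert R ti)
    `<=` big_box (1 + e).
  move=> p; rewrite /open_corner /dot /= !scale1E => h; apply/boxP; move: h.
  case: ti => -[] [[] []]; rewrite /pm_tvert /tvert /sg /= => -[h1 h2 h3 h4]; split; lra.
have := measure_fin_pack m mt mB mcor (@trivIset_cuboctahedron_corners R) dj tb cb.
rewrite (eq_bigr _ (fun i _ => cf i)) sumEFin tf m_big; last lra.
rewrite -EFinD lee_fin -mulr_sumr => h; apply: le_trans h.
rewrite normr1 expr1n invr1 mul1r lerD2l.
rewrite -(sum_pm (f := fun s => mu (corner s))); last first.
  by move=> i; rewrite mu_corner_opp//; exact: sign3_tvert.
apply: ler_sum => i _; rewrite -mu_corner_opp; last exact: sign3_pm_tvert.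
exact: corner_open_corner.
Qed.

(** The tetrahedron has measure at most 4K, so covering the cube gives 8c <= 12K, that is K >= 2c/3.
    Packing then leaves at most 8c - 8K <= 8c/3. *)
Lemma measure_tetra_le : (m (@tetra R) <= (8 / 3 * c)%:E)%E.
Proof.
rewrite (mu_fin (@measurable_tetra R) (tetra_big (ltr1n R 2))) lee_fin.
have := dissect_cube; have := dissect_tetra; have := pack_tetra.
by move: (mu (@tetra R)) K c => t k c'; lra.
Qed.

(** Again K >= 2c/3, and the eight corners leave at most 8c - 2K <= 20c/3. *)
Lemma measure_cuboctahedron_le : (m (cuboctahedron R) <= (20 / 3 * c)%:E)%E.
Proof.
have b p : cuboctahedron R p -> big_box 2 p.
  by move/cuboctahedron_abs; apply: abs_big; lra.
rewrite (mu_fin (@measurable_cuboctahedron R) b) lee_fin.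
have := dissect_cube; have := dissect_tetra; have := pack_cuboctahedron.
by move: (mu (@tetra R)) (mu (cuboctahedron R)) K c => t t' k c'; lra.
Qed.

End DissectionMeasure.

(** * Densities *)

Section Volumes.
Variable R : realType.

Lemma vol_setX (A B C : set R) : measurable A -> measurable B -> measurable C ->
  vol ((A `*` B) `*` C) =
  (lebesgue_measure A * lebesgue_measure B * lebesgue_measure C)%E.
Proof.
move=> mA mB mC; rewrite /vol product_measure1E//; last exact: measurableX.
congr (_ * _)%E; exact: product_measure1E.
Qed.

Lemma vol_box (lo hi : space3 R) : box_le lo hi -> vol (box lo hi) = (box_vol lo hi)%:E.
Proof.
have itvE (a b : R) : a <= b -> lebesgue_measure `]a, b]%classic = (b - a)%:E.
  move=> ab; rewrite lebesgue_measure_itv /= lte_fin; case: ltrP => // ba.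
  by have -> : b = a by [apply: le_anti; rewrite ab ba]; rewrite subrr.
by move=> [h1 h2 h3]; rewrite vol_setX// !itvE.
Qed.

Lemma vol_le (A B : set (space3 R)) : measurable A -> measurable B ->
  A `<=` B -> (vol A <= vol B)%E.
Proof.
move=> mA mB AB.
by apply: (le_measure ((lebesgue_measure \x lebesgue_measure) \x lebesgue_measure)%E);
  rewrite ?inE.
Qed.

Lemma dilate_cubeWE (l : R) : 0 < l ->
  dilate l (cubeW R) = (`[- l, l] `*` `[- l, l]) `*` `[- l, l].
Proof.
move=> l0; apply/seteqP; split => [_ [[[x y] z] [/= h1 h2 h3] <-]|[[x y] z]].
  have e (u : R) : u \in `[-1, 1] -> l *: u \in `[- l, l].
    rewrite !in_itv /= scale1E => /andP[u1 u2].
    have k1 : 0 <= l * (u + 1) by apply: mulr_ge0; lra.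
    have k2 : 0 <= l * (1 - u) by apply: mulr_ge0; lra.
    by apply/andP; split; lra.
  by split; [split|]; exact: e.
case=> -[/= h1 h2] h3; exists (l^-1 *: ((x, y), z)); last by rewrite scalerA divff ?scale1r// gt_eqF.
have e (u : R) : u \in `[- l, l] -> l^-1 *: u \in `[-1, 1].
  by rewrite !in_itv /= scale1E ler_pdivlMl// ler_pdivrMl// mulr1 mulrN1.
by split; exact: e.
Qed.

Lemma vol_dilate_cubeW (l : R) : 0 < l -> vol (dilate l (cubeW R)) = ((2 * l) ^+ 3)%:E.
Proof.
move=> l0; rewrite dilate_cubeWE// vol_setX// lebesgue_measure_itv /= lte_fin.
rewrite (_ : - l < l); last lra.
by rewrite -!EFinB -!EFinM; congr (_%:E); ring.
Qed.

End Volumes.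

Section LinearImage.
Variable R : realType.
Implicit Types (p q a b d : space3 R).

Definition lin3 a b d p : space3 R := p.1.1 *: a + p.1.2 *: b + p.2 *: d.

Lemma lin3D a b d p q : lin3 a b d (p + q) = lin3 a b d p + lin3 a b d q.
Proof.
have E (x y z x' y' z' : space3 R) :
  x + x' + (y + y') + (z + z') = x + y + z + (x' + y' + z').
  by rewrite (addrACA x) (addrACA (x + y)).
by rewrite /lin3 !add3E !scalerDl E.
Qed.

Lemma lin3Z a b d k p : lin3 a b d (k *: p) = k *: lin3 a b d p.
Proof. by rewrite /lin3 !scale3E !scalerDr !scalerA. Qed.

Lemma lin3B a b d p q : lin3 a b d (p - q) = lin3 a b d p - lin3 a b d q.
Proof. by rewrite -scaleN1r lin3D lin3Z scaleN1r. Qed.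

Lemma measurable_lin3 a b d : measurable_fun [set: space3 R] (lin3 a b d).
Proof.
apply/measurable_fun_pairP; split.
  apply/measurable_fun_pairP; split.
    rewrite (_ : _ \o _ = fun p : space3 R => a.1.1 * p.1.1 + b.1.1 * p.1.2 + d.1.1 * p.2).
      exact: measurable_linear3.
    by apply/funext => p; rewrite /= !scale1E !(mulrC p.1.1, mulrC p.1.2, mulrC p.2).
  rewrite (_ : _ \o _ = fun p : space3 R => a.1.2 * p.1.1 + b.1.2 * p.1.2 + d.1.2 * p.2).
    exact: measurable_linear3.
  by apply/funext => p; rewrite /= !scale1E !(mulrC p.1.1, mulrC p.1.2, mulrC p.2).
rewrite (_ : _ \o _ = fun p : space3 R => a.2 * p.1.1 + b.2 * p.1.2 + d.2 * p.2).
  exact: measurable_linear3.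
by apply/funext => p; rewrite /= !scale1E !(mulrC p.1.1, mulrC p.1.2, mulrC p.2).
Qed.

Definition norm1 p : R := `|p.1.1| + `|p.1.2| + `|p.2|.

Lemma norm1D p q : norm1 (p + q) <= norm1 p + norm1 q.
Proof.
rewrite /norm1 !add3E; have h1 := ler_normD p.1.1 q.1.1.
have h2 := ler_normD p.1.2 q.1.2; have h3 := ler_normD p.2 q.2.
lra.
Qed.

Lemma norm1Z k p : norm1 (k *: p) = `|k| * norm1 p.
Proof. by rewrite /norm1 !scale3E !normrM !mulrDr. Qed.

Lemma norm1_ge0 p : 0 <= norm1 p.
Proof. by rewrite /norm1 !addr_ge0. Qed.

Lemma norm1_lin3 a b d q : norm1 (lin3 a b d q) <= (norm1 a + norm1 b + norm1 d) * norm1 q.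
Proof.
rewrite /lin3; have h1 := norm1D (q.1.1 *: a + q.1.2 *: b) (q.2 *: d).
have h2 := norm1D (q.1.1 *: a) (q.1.2 *: b).
rewrite !norm1Z in h1 h2.
apply: (le_trans h1); apply: (@le_trans _ _ (`|q.1.1| * norm1 a + `|q.1.2| * norm1 b + `|q.2| * norm1 d)).
  by rewrite lerD2r.
have na := norm1_ge0 a; have nb := norm1_ge0 b; have nd := norm1_ge0 d.
rewrite [norm1 q]/norm1; move: (norm1 a) (norm1 b) (norm1 d) na nb nd => x y z x0 y0 z0.
move: `|q.1.1| `|q.1.2| `|q.2| (normr_ge0 q.1.1) (normr_ge0 q.1.2) (normr_ge0 q.2) => u v w u0 v0 w0.
have := mulr_ge0 x0 v0; have := mulr_ge0 x0 w0; have := mulr_ge0 y0 u0.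
have := mulr_ge0 y0 w0; have := mulr_ge0 z0 u0; have := mulr_ge0 z0 v0.
by lra.
Qed.

Lemma norm1_big (r : R) p : norm1 p < r -> big_box r p.
Proof.
rewrite /norm1 => h; have := normr_ge0 p.1.1; have := normr_ge0 p.1.2; have := normr_ge0 p.2.
by move=> *; apply: abs_le_big; lra.
Qed.

End LinearImage.

Lemma limf_esup_pinfty_le (R : realType) (F : R -> \bar R) (theta r : R) :
  0 <= theta -> 0 <= r ->
  (forall l, 0 < l -> (F l <= (theta * ((l + r) / l) ^+ 3)%:E)%E) ->
  (limf_esup F (pinfty_nbhs R) <= theta%:E)%E.
Proof.
move=> th0 r0 hF; apply/lee_addgt0Pr => e e0.
(* Beyond L the ratio x = r / l satisfies x <= 1 and 7 theta x <= e, while (1 + x)^3 <= 1 + 7 x. *)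
pose L := r + 7 * r * theta / e + 1.
have q0 : 0 <= 7 * r * theta / e by rewrite divr_ge0 ?mulr_ge0// ltW.
have L0 : 0 < L by rewrite /L; lra.
apply: (@le_trans _ _ (ereal_sup (F @` [set l | L < l]))).
  apply: ereal_inf_lbound; exists [set l | L < l] => //.
  by exists L; split => //; rewrite num_real.
apply: ge_ereal_sup => _ [l /= Ll <-].
have l0 : 0 < l := lt_trans L0 Ll.
apply: (le_trans (hF l l0)); rewrite -EFinD lee_fin.
pose x := r / l.
have -> : (l + r) / l = 1 + x by rewrite /x mulrDl divff// gt_eqF.
have x0 : 0 <= x by rewrite divr_ge0// ltW.
have x1 : x <= 1 by rewrite /x ler_pdivrMr//; move: Ll q0; rewrite /L; lra.
have hx : 7 * theta * x <= e.
  rewrite /x mulrA ler_pdivrMr//.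
  have yl : 7 * r * theta / e <= l by move: Ll r0; rewrite /L; lra.
  have := ler_wpM2l (ltW e0) yl; rewrite mulrC divfK ?gt_eqF//; lra.
have k1 : 0 <= theta * (x * (1 - x)).
  by rewrite mulr_ge0// mulr_ge0// subr_ge0.
have k2 : 0 <= theta * (x * (1 - x) * (1 + x)).
  by apply: mulr_ge0 => //; apply: mulr_ge0; [apply: mulr_ge0|]; lra.
by move: hx k1 k2; move: x theta e {x0 x1 th0 hF e0 L q0 L0 Ll} => *; lra.
Qed.

(** * Density bounds in linear coordinates *)

Section DensityBound.
Variable R : realType.
Implicit Types p q y : space3 R.
Variables (a b d a' b' d' : space3 R).
Let g := lin3 a b d.
Let f := lin3 a' b' d'.
Hypothesis fK : cancel f g.
Hypothesis gK : cancel g f.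

(** Volume seen through the coordinates [f], in which the centres are apart and the prisms live. It
    stands in for the determinant in a change of variables. *)
Definition lin_measure : {measure set (space3 R) -> \bar R} :=
  image_measure ((lebesgue_measure \x lebesgue_measure) \x lebesgue_measure)%E
    (measurable_lin3 a' b' d').

Lemma lin_measureE A : lin_measure A = vol (f @^-1` A).
Proof. by []. Qed.

Lemma measurable_lin_preimage A : measurable A -> measurable (f @^-1` A).
Proof. exact: (measurable_preimage (measurable_lin3 a' b' d')). Qed.

Lemma lin_measure_affine : affine_covariant lin_measure.
Proof.
move=> k v A k0 mA; rewrite !lin_measureE -(vol_affine (g v) k0 (measurable_lin_preimage mA)).
by congr (vol _); apply/seteqP; split => p; rewrite /preimage /= /f lin3D lin3Z -/f gK.
Qed.

Let r0 := norm1 a + norm1 b + norm1 d.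

Lemma norm1_g q : norm1 (g q) <= r0 * norm1 q.
Proof. exact: norm1_lin3. Qed.

Let r0_ge0 : 0 <= r0.
Proof. by rewrite /r0 !addr_ge0// norm1_ge0. Qed.

Lemma box_norm1 p : box (- pt 1 1 1) (pt (17/16) 1 1) p -> norm1 p < 4.
Proof.
move=> /boxP[/= /andP[h1 h1'] /andP[h2 h2'] /andP[h3 h3']].
have e1 : `|p.1.1| <= 17/16 by rewrite ler_norml; lra.
have e2 : `|p.1.2| <= 1 by rewrite ler_norml; lra.
have e3 : `|p.2| <= 1 by rewrite ler_norml; lra.
by rewrite /norm1; lra.
Qed.

Lemma lin_measure_fin : (lin_measure (box (pt 0 0 0) (pt 1 1 1)) < +oo)%E.
Proof.
pose r := r0 * 4 + 1.
have rp : 0 < r by rewrite /r ltr_wpDl// mulr_ge0.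
apply: (@le_lt_trans _ _ (vol (big_box r))); last first.
  by rewrite vol_box ?ltry//; split; rewrite /=; lra.
apply: vol_le.
- by apply: measurable_lin_preimage; exact: measurable_box.
- exact: measurable_box.
move=> p /boxP[/= h1 h2 h3].
have n4 : norm1 (f p) < 4.
  by apply: box_norm1; apply/boxP; split; rewrite /=; lra.
apply: norm1_big; rewrite -(fK p); apply: le_lt_trans (norm1_g _) _.
rewrite /r; apply: ltr_pwDr => //; apply: ler_wpM2l => //; exact: ltW.
Qed.

Let c := fine (lin_measure (box (pt 0 0 0) (pt 1 1 1))).
Let c_ge0 : 0 <= c. Proof. by rewrite fine_ge0. Qed.

Variable (X : set (space3 R)).
Hypothesis X_apart : forall x y, X x -> X y -> x != y -> apart (f x) (f y).

Let r := 4 * r0 + 1.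

(** In the original space each prism stays within distance r of its centre, so all of them lie in a
    cube of edge 2 (l + r), while together they measure at least 868/125 c per centre. *)
Lemma finite_count (l : R) (Y : seq (space3 R)) : 0 < l -> uniq Y ->
  (forall y, y \in Y -> X y /\ dilate l (cubeW R) y) ->
  (size Y)%:R * (c * (868 / 125)) <= (2 * (l + r)) ^+ 3.
Proof.
move=> l0 uY hY.
have finj : injective f := can_inj fK.
have rp : 0 < r by rewrite /r ltr_wpDl// mulr_ge0.
have := @measure_prisms_ge R lin_measure c c_ge0
  (measure_box lin_measure_affine lin_measure_fin) (map f Y).
rewrite map_inj_uniq// size_map => /(_ uY) h.
rewrite -lee_fin.
apply: (@le_trans _ _ (vol (big_box (l + r)))); last first.
  rewrite vol_box; last by split; rewrite /=; lra.
  by rewrite lee_fin le_eqVlt; apply/orP; left; apply/eqP; rewrite /box_vol /=; ring.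
apply: le_trans (h _) _.
  move=> _ _ /mapP[y yY ->] /mapP[y' y'Y ->] ne.
  have [Xy _] := hY _ yY; have [Xy' _] := hY _ y'Y.
  by apply: X_apart => //; apply: contraNneq ne => ->.
apply: vol_le.
- by apply: measurable_lin_preimage; exact: measurable_prisms.
- exact: measurable_box.
move=> p [_ /mapP[y yY ->] yp].
have [_] := hY _ yY; rewrite dilate_cubeWE// => -[[/= y1 y2] y3].
have n4 : norm1 (f (p - y)) < 4.
  rewrite /f lin3B -/f; apply: box_norm1.
  have {}yp : prism (f y) (f p) := yp.
  move/prismP: yp; move: (f p) (f y) => u v [h1 h2 h3].
  by apply/boxP; split; rewrite /=; move: h1 h2 h3; lra.
have nr : norm1 (p - y) < r.
  rewrite -(fK (p - y)); apply: le_lt_trans (norm1_g _) _.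
  by rewrite /r mulrC; apply: ltr_pwDr => //; apply: ler_wpM2r => //; exact: ltW.
move: y1 y2 y3; rewrite !in_itv /= => y1 y2 y3.
have /boxP[/= k1 k2 k3] := norm1_big nr.
by apply/boxP; split; rewrite /=; move: y1 y2 y3 k1 k2 k3; lra.
Qed.

Variables (K : set (space3 R)) (kK : R).
Hypothesis kK_ge0 : 0 <= kK.
Hypothesis volK : (vol K <= (kK * c)%:E)%E.

Lemma upper_density_le : (upper_density K X <= (kK * (125 / 868))%:E)%E.
Proof.
have volK_ge0 : (0 <= vol K)%E by exact: measure_ge0.
have rp : 0 < r by rewrite /r ltr_wpDl// mulr_ge0.
have th0 : 0 <= kK * (125 / 868) by apply: mulr_ge0; [exact: kK_ge0|lra].
apply: (limf_esup_pinfty_le th0 (ltW rp)) => l l0.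
have lr0 : 0 < l + r by rewrite addr_gt0.
have rhs0 : 0 <= kK * (125 / 868) * ((l + r) / l) ^+ 3.
  by apply: mulr_ge0; [exact: th0|apply/exprn_ge0/divr_ge0; exact: ltW].
(* If K has volume 0 the density is 0. Otherwise c is positive, and the count can be bounded by
   dividing by c. *)
have [K0|Kn0] := eqVneq (vol K) 0%E.
  by rewrite K0 mule0 mul0e lee_fin.
have c0 : 0 < c.
  rewrite lt_neqAle c_ge0 andbT; apply: contraNneq Kn0 => c0.
  by move: volK; rewrite -c0 mulr0 => vK; apply/eqP/le_anti/andP.
have finS : finite_set (X `&` dilate l (cubeW R)).
  apply: contrapT => infS.
  have c1 : 0 < c * (868 / 125) by apply: mulr_gt0; [exact: c0|lra].
  (* N points would already exceed the bound of [finite_count], so the count cannot be infinite. *)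
  pose N := (Num.truncn ((2 * (l + r)) ^+ 3 / (c * (868 / 125)))).+1.
  have [B BS NB] := infinite_set_fset N infS.
  have hB y : y \in enum_fset B -> X y /\ dilate l (cubeW R) y.
    by move=> yB; have [? ?] := BS y yB.
  have := finite_count l0 (fset_uniq B) hB.
  have NB' : N%:R <= (size (enum_fset B))%:R :> R by rewrite ler_nat.
  apply/negP; rewrite -ltNge -ltr_pdivrMr//; apply: lt_le_trans NB'.
  by rewrite /N truncnS_gt.
rewrite /counting asboolT// vol_dilate_cubeW//.
set S := fset_set _.
have hS : (size (enum_fset S))%:R * (c * (868 / 125)) <= (2 * (l + r)) ^+ 3.
  apply: finite_count => //; first exact: fset_uniq.
  by move=> y; rewrite in_fset_set// inE => -[].
have l3 : 0 < (2 * l) ^+ 3 by rewrite exprn_gt0// mulr_gt0.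
apply: (@le_trans _ _ ((size (enum_fset S))%:R%:E * (kK * c)%:E / ((2 * l) ^+ 3)%:E)%E).
  rewrite lee_wpmul2r//; first by rewrite inver gt_eqF// lee_fin invr_ge0 ltW.
  by rewrite lee_wpmul2l// lee_fin.
rewrite inver gt_eqF// -!EFinM lee_fin ler_pdivrMr//.
have -> : kK * (125 / 868) * ((l + r) / l) ^+ 3 * (2 * l) ^+ 3 =
    kK * (125 / 868) * (2 * (l + r)) ^+ 3.
  by field; rewrite gt_eqF.
apply: le_trans (ler_wpM2l th0 hS).
by rewrite le_eqVlt; apply/orP; left; apply/eqP; field.
Qed.

End DensityBound.

(** * Packings of cuboctahedra *)

Section Packings.
Variable R : realType.
Implicit Types (p q x y : space3 R).

Lemma continuous_coords :
  [/\ continuous (fun p : space3 R => p.1.1 : R), continuous (fun p : space3 R => p.1.2 : R) &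
   continuous (fun p : space3 R => p.2 : R)].
Proof.
split => p.
- by apply: (@cvg_comp _ _ _ fst fst); exact: cvg_fst.
- by apply: (@cvg_comp _ _ _ fst snd); [exact: cvg_fst|exact: cvg_snd].
- exact: cvg_snd.
Qed.

Lemma continuous_linear3 (s : space3 R) (k : R) : continuous (fun p : space3 R => dot s p + k : R).
Proof.
have [c1 c2 c3] := continuous_coords.
move=> p; apply: cvgD; last exact: cvg_cst.
apply: cvgD; first apply: cvgD.
- by apply: cvgM; [exact: cvg_cst|exact: c1].
- by apply: cvgM; [exact: cvg_cst|exact: c2].
- by apply: cvgM; [exact: cvg_cst|exact: c3].
Qed.

Lemma packing_apart_of (K X : set (space3 R)) (P : space3 R -> space3 R -> Prop) :
  packing K X ->
  (forall x y, ~ P x y -> exists p, interior (translate K x) p /\ interior (translate K y) p) ->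
  forall x y, X x -> X y -> x != y -> P x y.
Proof.
move=> /trivIsetP pK h x y Xx Xy xy; apply: contrapT => /h[p [xp yp]].
by have : set0 p by rewrite -(pK x y Xx Xy xy).
Qed.

Lemma near_continuous_lt (f : space3 R -> R) (r : R) p : continuous f -> f p < r ->
  \forall q \near p, f q < r.
Proof. by move=> cf h; exact: (cvgr_lt _ (cf p) _ h). Qed.

Lemma interior_translate_cuboctahedron x p :
  `|p.1.1 - x.1.1| < 1 -> `|p.1.2 - x.1.2| < 1 -> `|p.2 - x.2| < 1 ->
  `|p.1.1 - x.1.1| + `|p.1.2 - x.1.2| + `|p.2 - x.2| < 2 ->
  interior (translate (cuboctahedron R) x) p.
Proof.
have [c1 c2 c3] := continuous_coords.
have n1 : continuous (fun q : space3 R => `|q.1.1 - x.1.1| : R).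
  by move=> q; apply: cvg_norm; apply: cvgB; [exact: c1|exact: cvg_cst].
have n2 : continuous (fun q : space3 R => `|q.1.2 - x.1.2| : R).
  by move=> q; apply: cvg_norm; apply: cvgB; [exact: c2|exact: cvg_cst].
have n3 : continuous (fun q : space3 R => `|q.2 - x.2| : R).
  by move=> q; apply: cvg_norm; apply: cvgB; [exact: c3|exact: cvg_cst].
have n4 : continuous (fun q : space3 R =>
    `|q.1.1 - x.1.1| + `|q.1.2 - x.1.2| + `|q.2 - x.2| : R).
  by move=> q; apply: cvgD; [apply: cvgD; [exact: n1|exact: n2]|exact: n3].
move=> /(near_continuous_lt n1) h1 /(near_continuous_lt n2) h2 /(near_continuous_lt n3) h3 /(near_continuous_lt n4) h4.
rewrite /interior; near=> q; exists (q - x); last by rewrite subrK.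
by apply/cuboctahedronP; split; rewrite /=; apply: ltW; near: q.
Unshelve. all: by end_near. Qed.

(** If the difference y - x were interior to twice the cuboctahedron, the midpoint of x and y would
    be interior to both translates. *)
Lemma cuboctahedron_packing_apart X : packing (cuboctahedron R) X ->
  forall x y, X x -> X y -> x != y -> apart x y.
Proof.
move=> pK; apply: (packing_apart_of pK) => x y nxy.
have h1 : `|y.1.1 - x.1.1| < 2 by rewrite ltNge; apply/negP => h; apply: nxy; constructor 1.
have h2 : `|y.1.2 - x.1.2| < 2 by rewrite ltNge; apply/negP => h; apply: nxy; constructor 2.
have h3 : `|y.2 - x.2| < 2 by rewrite ltNge; apply/negP => h; apply: nxy; constructor 3.
have h4 : `|y.1.1 - x.1.1| + `|y.1.2 - x.1.2| + `|y.2 - x.2| < 4.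
  by rewrite ltNge; apply/negP => h; apply: nxy; constructor 4.
have half (u v : R) : `|(u + v) / 2 - u| = `|v - u| / 2 /\ `|(u + v) / 2 - v| = `|v - u| / 2.
  have n2 (w : R) : `|w / 2| = `|w| / 2 by rewrite normrM (gtr0_norm (x := 2^-1)) ?invr_gt0.
  by rewrite -n2; split; [|rewrite distrC]; congr `|_|; field.
exists (pt ((x.1.1 + y.1.1) / 2) ((x.1.2 + y.1.2) / 2) ((x.2 + y.2) / 2)).
have [e1 e1'] := half x.1.1 y.1.1; have [e2 e2'] := half x.1.2 y.1.2.
have [e3 e3'] := half x.2 y.2.
split; apply: interior_translate_cuboctahedron; rewrite /= ?e1 ?e2 ?e3 ?e1' ?e2' ?e3'; lra.
Qed.

Lemma lin3_id p : lin3 (pt 1 0 0) (pt 0 1 0) (pt 0 0 1) p = p.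
Proof.
case: p => -[x y] z; rewrite /lin3; congr (_, _, _);
  by rewrite /= !scale1E !mulr0 mulr1 ?addr0 ?add0r.
Qed.

Lemma cuboctahedron_density X : packing (cuboctahedron R) X ->
  (upper_density (cuboctahedron R) X <= (625 / 651)%:E)%E.
Proof.
move=> pX.
have idK : cancel (lin3 (pt 1 0 0) (pt 0 1 0) (pt 0 0 1)) (lin3 (pt 1 0 0) (pt 0 1 0) (pt 0 0 1) : space3 R -> _).
  by move=> p; rewrite !lin3_id.
have -> : 625 / 651 = 20 / 3 * (125 / 868) :> R by field.
apply: (upper_density_le idK idK).
- by move=> x y Xx Xy xy; rewrite !lin3_id; exact: cuboctahedron_packing_apart pX x y Xx Xy xy.
- lra.
have := measure_cuboctahedron_le (lin_measure_affine idK) (lin_measure_fin idK).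
rewrite lin_measureE (_ : _ @^-1` cuboctahedron R = cuboctahedron R)//.
by apply/seteqP; split => p; rewrite /preimage /= lin3_id.
Qed.

End Packings.

(** * Packings of simplices *)

Section Convex.
Variable R : realType.
Implicit Types (A : set (space3 R)) (p q x y : space3 R).

Lemma convex_setP A : @convex_set R (space3 R) A <->
  forall x y (k : R), A x -> A y -> 0 <= k -> k <= 1 -> A (k *: x + (1 - k) *: y).
Proof.
split => [cA x y k Ax Ay k0 k1|cA x y k /set_mem Ax /set_mem Ay].
  by have := cA x y (Itv01 k0 k1) (mem_set Ax) (mem_set Ay) => /set_mem.
by apply/mem_set; apply: cA.
Qed.

(** Keeping the total weight as a factor allows repeated use without normalizing, even when weights
    vanish. *)
Lemma convex_cone A x y (s t : R) : @convex_set R (space3 R) A -> A x -> A y ->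
  0 <= s -> 0 <= t -> exists2 z, A z & s *: x + t *: y = (s + t) *: z.
Proof.
move=> /convex_setP cA Ax Ay s0 t0.
have [st0|st0] := eqVneq (s + t) 0.
  have [/eqP -> /eqP ->] : s == 0 /\ t == 0 by apply/andP; rewrite -paddr_eq0// st0.
  by exists x; rewrite // !scale0r addr0 addr0 scale0r.
have stp : 0 < s + t by rewrite lt_neqAle eq_sym st0 addr_ge0.
exists ((s / (s + t)) *: x + (1 - s / (s + t)) *: y).
  apply: cA => //; first by rewrite divr_ge0// ltW.
  by rewrite ler_pdivrMr// mul1r lerDl.
rewrite scalerDr !scalerA; congr (_ *: _ + _ *: _); first by rewrite mulrC divfK.
by rewrite mulrBr mulr1 (mulrC _ (s / _)) divfK// addrAC subrr add0r.
Qed.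
End Convex.

(** The sum of positive parts is the largest scalar product of v with a sum of some of the four
    vertices. Such a sum is 0, plus or minus a cube vertex, or twice a signed unit vector. *)
Lemma sum_max_dot (R : realType) (v : space3 R)
    (m := fun i => Num.max 0 (dot (tvert R i) v)) :
  `|v.1.1| < 2 -> `|v.1.2| < 2 -> `|v.2| < 2 -> `|v.1.1| + `|v.1.2| + `|v.2| < 4 ->
  m (true, true) + m (true, false) + m (false, true) + m (false, false) < 4.
Proof.
have := ler_norm v.1.1; have := ler_norm v.1.2; have := ler_norm v.2.
have := ler_norm (- v.1.1); have := ler_norm (- v.1.2); have := ler_norm (- v.2).
rewrite !normrN.
have mc i : m i = 0 \/ m i = dot (tvert R i) v.
  by rewrite /m /Num.max; case: ifP; [right|left].
case: (mc (true, true)) => ->; case: (mc (true, false)) => ->;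
case: (mc (false, true)) => ->; case: (mc (false, false)) => ->;
rewrite /dot /tvert /sg /=;
move: `|v.1.1| `|v.1.2| `|v.2| v.1.1 v.1.2 v.2 => n1 n2 n3 v1 v2 v3; clear;
by move=> k1 k2 k3 k4 k5 k6 h1 h2 h3 h4; lra.
Qed.

Section Simplex.
Variable R : realType.
Implicit Types (p q x y : space3 R).
Variables (a b d a' b' d' o : space3 R).
Let g := lin3 a b d.
Let f := lin3 a' b' d'.
Hypothesis fK : cancel f g.
Hypothesis gK : cancel g f.

Definition simplex : set (space3 R) := convex_hull (range (fun i => o + g (tvert R i))).

Lemma dotD s p q : dot s (p + q) = dot s p + dot s q :> R.
Proof. by rewrite /dot !add3E; ring. Qed.
Lemma dotZ s k p : dot s (k *: p) = k * dot s p :> R.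
Proof. by rewrite /dot !scale3E; ring. Qed.

Lemma dotN s p : dot s (- p) = - dot s p :> R.
Proof. by rewrite /dot !opp3E; ring. Qed.

(** The l i are the barycentric coordinates of q: the vertices sum to 0 and the sum of their
    projections [dot (tvert R i) q *: tvert R i] is 4 q. *)
Lemma tvert_barycentric q (l := fun i => (1 + dot (tvert R i) q) / 4) :
  l (true, true) *: tvert R (true, true) + l (true, false) *: tvert R (true, false) +
  (l (false, true) *: tvert R (false, true) + l (false, false) *: tvert R (false, false)) = q.
Proof.
rewrite /l; case: q {l} => -[q1 q2] q3; rewrite /dot /tvert /sg /=.
by congr (_, _, _); rewrite /= !scale1E; field.
Qed.

Lemma simplexE : simplex = [set p | tetra (f (p - o))].
Proof.
apply/seteqP; split.
  apply: smallest_sub.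
    apply/convex_setP => x y k Tx Ty k0 k1 i /=.
    have -> : f (k *: x + (1 - k) *: y - o) = k *: f (x - o) + (1 - k) *: f (y - o).
      rewrite -!lin3Z -lin3D; congr (f _).
      rewrite !scalerBr addrACA -opprD -scalerDl (addrC k) subrK scale1r.
      by [].
    have hv : - dot (tvert R i) (f (x - o)) <= 1 := Tx i.
    have hu : - dot (tvert R i) (f (y - o)) <= 1 := Ty i.
    rewrite dotD !dotZ; move: hu hv.
    move: (dot _ (f (x - o))) (dot _ (f (y - o))) => v u hu hv.
    have k1' : 0 <= 1 - k by lra.
    have m1 : 0 <= k * (1 + v) by apply: mulr_ge0; lra.
    have m2 : 0 <= (1 - k) * (1 + u) by apply: mulr_ge0; lra.
    lra.
  move=> _ [i _ <-] j /=; rewrite addrAC subrr add0r gK /dot /tvert /sg.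
  by case: i => -[] -[]; case: j => -[] -[] /=; lra.
move=> p Tp A [/= cA wA].
have wi i : A (o + g (tvert R i)) by apply: wA; exists i.
move: Tp => /=; set q := f (p - o) => Tq.
pose l i := (1 + dot (tvert R i) q) / 4.
have l0 i : 0 <= l i.
  have := Tq i; rewrite /l; move: (dot _ _) => u; lra.
(* The four vertices are combined with their barycentric weights, first in pairs and then the two
   pairs. *)
have [x Ax Ex] := convex_cone cA (wi (true, true)) (wi (true, false)) (l0 (true, true)) (l0 (true, false)).
have [y Ay Ey] := convex_cone cA (wi (false, true)) (wi (false, false)) (l0 (false, true)) (l0 (false, false)).
have [z Az Ez] := convex_cone cA Ax Ay
  (addr_ge0 (l0 (true, true)) (l0 (true, false)))
  (addr_ge0 (l0 (false, true)) (l0 (false, false))).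
suff -> : p = z by [].
have s1 : l (true, true) + l (true, false) + (l (false, true) + l (false, false)) = 1.
  by rewrite /l /dot /tvert /sg /=; field.
move: Ez; rewrite s1 scale1r -Ex -Ey => <-.
have gZ (k : R) u : k *: g u = g (k *: u) by rewrite /g lin3Z.
have gD u v : g u + g v = g (u + v) by rewrite /g lin3D.
have hl (k : R) u : k *: (o + g u) = k *: o + g (k *: u) by rewrite scalerDr gZ.
rewrite !hl.
have E (u1 u2 u3 u4 v1 v2 v3 v4 : space3 R) :
    u1 + v1 + (u2 + v2) + (u3 + v3 + (u4 + v4)) =
    (u1 + u2 + (u3 + u4)) + (v1 + v2 + (v3 + v4)).
  by rewrite (addrACA u1) (addrACA u3) (addrACA (u1 + u2)).
have so : l (true, true) *: o + l (true, false) *: o +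
    (l (false, true) *: o + l (false, false) *: o) = o by rewrite -!(scalerDl o) s1 scale1r.
rewrite E so !gD.
rewrite (tvert_barycentric q).
by rewrite /q fK addrC subrK.
Qed.

Lemma interior_translate_simplex x p :
  (forall i, - dot (tvert R i) (f (p - x - o)) < 1) -> interior (translate simplex x) p.
Proof.
move=> h.
have cont i : continuous (fun q : space3 R => - dot (tvert R i) (f (q - x - o)) : R).
  (* s is the coefficient vector of the linear form sending q to [- dot (tvert R i) (f q)]. *)
  pose s := pt (- dot (tvert R i) a') (- dot (tvert R i) b') (- dot (tvert R i) d').
  rewrite (_ : (fun q => _) = fun q => dot s q + - dot s (x + o)).
    exact: continuous_linear3.
  apply/funext => q; rewrite /f /lin3 !dotD !dotZ /s /dot /= .
  by rewrite ?opprD; ring.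
have := filter_forall (nbhs_filter p) (fun i => near_continuous_lt (cont i) (h i)).
move=> nq; rewrite /interior; apply: (@filterS _ _ (nbhs_filter p) _ _ _ nq) => q hq; exists (q - x); last by rewrite subrK.
by rewrite simplexE => i; exact: ltW (hq i).
Qed.

(* If v = f y - f x were interior to twice the cuboctahedron, then the point q below
   and q - v would both be interior to the tetrahedron. *)
Lemma simplex_packing_apart X : packing simplex X ->
  forall x y, X x -> X y -> x != y -> apart (f x) (f y).
Proof.
move=> pK; apply: (packing_apart_of pK) => x y nxy.
pose v := f y - f x.
have h1 : `|v.1.1| < 2 by rewrite ltNge; apply/negP => h; apply: nxy; constructor 1.
have h2 : `|v.1.2| < 2 by rewrite ltNge; apply/negP => h; apply: nxy; constructor 2.
have h3 : `|v.2| < 2 by rewrite ltNge; apply/negP => h; apply: nxy; constructor 3.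
have h4 : `|v.1.1| + `|v.1.2| + `|v.2| < 4.
  by rewrite ltNge; apply/negP => h; apply: nxy; constructor 4.
pose m i := Num.max 0 (dot (tvert R i) v).
have m0 i : 0 <= m i by rewrite le_max lexx.
have mv i : dot (tvert R i) v <= m i by rewrite le_max lexx orbT.
have M4 : m (true, true) + m (true, false) + m (false, true) + m (false, false) < 4.
  exact: sum_max_dot.
(* Vertices have scalar products 3 with themselves and -1 with each other, so [dot (tvert R i) q] is
   m i minus a quarter of the sum of all m. That sum is below 4; m i >= 0 then puts q inside, and m
   i >= [dot (tvert R i) v] puts q - v inside. *)
pose q : space3 R := 4^-1 *: (m (true, true) *: tvert R (true, true) +
  m (true, false) *: tvert R (true, false) + m (false, true) *: tvert R (false, true) +
  m (false, false) *: tvert R (false, false)).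
have qE i : - dot (tvert R i) q = (m (true, true) + m (true, false) + m (false, true) + m (false, false)) / 4 - m i.
  by rewrite /q dotZ !dotD !dotZ; case: i => -[] -[]; rewrite /dot /tvert /sg /=; lra.
exists (x + o + g q); split; apply: interior_translate_simplex => i.
  have -> : x + o + g q - x - o = g q by rewrite -addrA -opprD addrC addKr.
  rewrite gK qE; have := m0 i; move: (m i) M4 => mi; lra.
have -> : f (x + o + g q - y - o) = q - v.
  have -> : x + o + g q - y - o = g q - (y - x).
    rewrite opprB; move: (g q) => G.
    by rewrite -(addrA x) (addrC x) -!addrA (addrC o) !addrA subrK.
  by rewrite /f lin3B -/f gK /v /f lin3B.
rewrite dotD dotN opprD opprK qE.
have := mv i; move: (m i) (dot _ v) M4 => mi di; lra.
Qed.

Lemma simplex_density X : packing simplex X ->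
  (upper_density simplex X <= (250 / 651)%:E)%E.
Proof.
move=> pX.
have -> : 250 / 651 = 8 / 3 * (125 / 868) :> R by field.
apply: (upper_density_le fK gK).
- exact: simplex_packing_apart.
- lra.
have h := measure_tetra_le (lin_measure_affine gK) (lin_measure_fin fK).
apply: le_trans h; rewrite lin_measureE.
have mt := measurable_preimage (measurable_lin3 a' b' d') (@measurable_tetra R).
have := vol_affine (- o) (oner_neq0 R) mt.
rewrite normr1 expr1n invr1 mul1e => <-.
rewrite simplexE le_eqVlt; apply/orP; left; apply/eqP; congr (vol _).
by apply/seteqP; split => p; rewrite /preimage /= scale1r.
Qed.

End Simplex.

(** * Regular tetrahedra and the final constants *)

Section Regular.
Variable R : realType.
Implicit Types (a b d p : space3 R).

Definition cross a b : space3 R :=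
  pt (a.1.2 * b.2 - a.2 * b.1.2) (a.2 * b.1.1 - a.1.1 * b.2) (a.1.1 * b.1.2 - a.1.2 * b.1.1).

Definition det3 a b d : R := dot a (cross b d).

(** Cramer's rule: the inverse matrix has the cross products divided by the determinant as its
    rows. *)
Lemma lin3_inverse a b d : det3 a b d != 0 ->
  exists a' b' d', cancel (lin3 a' b' d') (lin3 a b d) /\ cancel (lin3 a b d) (lin3 a' b' d').
Proof.
move=> D0; pose D := det3 a b d.
exists (pt ((cross b d).1.1 / D) ((cross d a).1.1 / D) ((cross a b).1.1 / D)),
  (pt ((cross b d).1.2 / D) ((cross d a).1.2 / D) ((cross a b).1.2 / D)),
  (pt ((cross b d).2 / D) ((cross d a).2 / D) ((cross a b).2 / D)).
move: D0; rewrite /D /det3 /dot /cross /=.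
case: a {D} => -[a1 a2] a3; case: b => -[b1 b2] b3; case: d => -[d1 d2] d3 /= D0.
by split => -[[x y] z]; congr (_, _, _); rewrite /= !scale1E; field.
Qed.

(** The Gram determinant, which expresses nondegeneracy by the scalar products that the edge lengths
    determine. *)
Lemma det3_sqr a b d : det3 a b d ^+ 2 =
  dot a a * dot b b * dot d d + 2 * dot a b * dot b d * dot d a
  - dot a a * dot b d ^+ 2 - dot b b * dot d a ^+ 2 - dot d d * dot a b ^+ 2.
Proof. by rewrite /det3 /dot /cross /=; ring. Qed.

Definition vertex_index (i : bool * bool) : 'I_4 :=
  match i with
  | (true, true) => @Ordinal 4 0 isT
  | (true, false) => @Ordinal 4 1 isT
  | (false, true) => @Ordinal 4 2 isT
  | (false, false) => @Ordinal 4 3 isT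
  end.

Lemma vertex_index_surj k : exists i, vertex_index i = k.
Proof.
case: k => -[|[|[|[|k]]]] h //;
  [exists (true, true)|exists (true, false)|exists (false, true)|exists (false, false)];
  exact: val_inj.
Qed.

Lemma regular_simplex (T : set (space3 R)) : regular_tetrahedron T ->
  exists a b d o, det3 a b d != 0 /\ T = simplex a b d o.
Proof.
move=> [v [s [s0 vs ->]]].
pose w i := v (vertex_index i).
have dist i j : i != j -> (w i - w j).1.1 ^+ 2 + (w i - w j).1.2 ^+ 2 + (w i - w j).2 ^+ 2 = s ^+ 2.
  move=> ij; have : vertex_index i != vertex_index j by case: i j ij => -[] [] [[] []].
  move=> /vs <-; rewrite /euclidean_dist sqr_sqrtr//.
  by rewrite !addr_ge0 ?sqr_ge0.
(* Solution of the linear system w i = o + g (tvert i), obtained by adding the four equations with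
   signs. *)
pose a := 4^-1 *: (w (true, true) - w (true, false) - w (false, true) + w (false, false)).
pose b := 4^-1 *: (w (true, true) + w (true, false) - w (false, true) - w (false, false)).
pose d := 4^-1 *: (w (true, true) - w (true, false) + w (false, true) - w (false, false)).
pose o := 4^-1 *: (w (true, true) + w (true, false) + w (false, true) + w (false, false)).
have wE i : w i = o + lin3 a b d (tvert R i).
  rewrite /a /b /d /o; case: i => -[] -[];
  move: (w (true, true)) (w (true, false)) (w (false, true)) (w (false, false));
  by move=> -[[p1 p2] p3] [[q1 q2] q3] [[r1 r2] r3] [[t1 t2] t3]; congr (_, _, _);
    rewrite /= /tvert /sg /= !scale1E; field.
exists a, b, d, o; split; last first.
  congr convex_hull; apply/seteqP; split => _ [k _ <-].
    by have [i <-] := vertex_index_surj k; exists i => //; rewrite -wE.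
  by exists (vertex_index k) => //; rewrite -wE.
have d1 := dist (true, true) (true, false) isT; have d2 := dist (true, true) (false, true) isT.
have d3 := dist (true, true) (false, false) isT; have d4 := dist (true, false) (false, true) isT.
have d5 := dist (true, false) (false, false) isT; have d6 := dist (false, true) (false, false) isT.
(* Equal edges make a, b, d orthogonal. The inscribed tetrahedron has squared edge 8, hence the
   squared length s^2 / 8. *)
have [aa bb dd ab bd] : [/\ dot a a = s ^+ 2 / 8, dot b b = s ^+ 2 / 8, dot d d = s ^+ 2 / 8,
    dot a b = 0 & dot b d = 0 /\ dot d a = 0].
  move: d1 d2 d3 d4 d5 d6; rewrite /a /b /d /dot; move: (s ^+ 2) => S.
  case: (w (true, true)) (w (true, false)) (w (false, true)) (w (false, false))
    => [[p1 p2] p3] [[q1 q2] q3] [[r1 r2] r3] [[t1 t2] t3] /=; rewrite !scale1E.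
  by move=> d1 d2 d3 d4 d5 d6; split; [| | | |split]; lra.
apply/eqP => D0; have := det3_sqr a b d.
rewrite D0 aa bb dd ab (proj1 bd) (proj2 bd).
have sp : 0 < s ^+ 2 by rewrite exprn_gt0.
by have := mulr_gt0 (mulr_gt0 sp sp) sp; move: (s ^+ 2) => S; lra.
Qed.

Lemma tetrahedron_density (T X : set (space3 R)) : regular_tetrahedron T -> packing T X ->
  (upper_density T X <= (250 / 651)%:E)%E.
Proof.
move=> /regular_simplex[a [b [d [z [D0 ->]]]]].
have [a' [b' [d' [fK gK]]]] := lin3_inverse D0.
exact: (simplex_density fK gK).
Qed.

(** Both inequalities amount to s <= 500/157, and 159/50 lies between the root of 10 and this
    number. *)
Lemma density_constants (s := Num.sqrt 10 : R) :
  625 / 651 <= 90 * s / (95 * s - 4) /\ 250 / 651 <= 36 * s / (95 * s - 4).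
Proof.
have s2 : s ^+ 2 = 10 by rewrite sqr_sqrtr.
have s0 : 0 <= s by rewrite sqrtr_ge0.
have s3 : 3 <= s.
  rewrite leNgt; apply/negP => h.
  have : 0 <= (3 - s) * (3 + s) by apply: mulr_ge0; lra.
  by lra.
have s4 : s <= 159 / 50.
  rewrite leNgt; apply/negP => h.
  have : 0 <= (s - 159 / 50) * (s + 159 / 50) by apply: mulr_ge0; lra.
  by lra.
have p : 0 < 95 * s - 4 by lra.
by split; rewrite ler_pdivlMr//; lra.
Qed.

End Regular.

Theorem mainTheorem1 (R : realType) (T : set (space3 R))
    (hT : regular_tetrahedron T) :
  (translative_density (cuboctahedron R)
     <= (90 * Num.sqrt 10 / (95 * Num.sqrt 10 - 4))%:E)%E /\
  (translative_density T
     <= (36 * Num.sqrt 10 / (95 * Num.sqrt 10 - 4))%:E)%E.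
Proof.
have [c1 c2] := density_constants R.
split; apply: ge_ereal_sup => _ [X [_ pX] <-].
  by apply: le_trans (cuboctahedron_density pX) _; rewrite lee_fin.
by apply: le_trans (tetrahedron_density hT pX) _; rewrite lee_fin.
Qed.
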